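(* Let $P\subseteq \mathbb{R}^2$ be a rational polygon with denominator $l\in \mathbb{Z}_{\geq 2}$ and with $k>1$ interior integral points, i.e. $k=|\mathrm{int}(P)\cap\mathbb{Z}^2|$. Then $$\mathrm{area}(P)\leq \mathrm{area}(T_{k,l})=\frac{(l+1)^2}{2l} (k+1),$$ and this bound is sharp.
   Context: A rational polygon is a two-dimensional convex polygon in $\mathbb{R}^2$ whose vertices have rational coordinates; its denominator is the smallest $l\in\mathbb{Z}_{\geq1}$ such that $lP$ has integral vertices. $T_{k,l}$ is the triangle $$T_{k,l}:=\mathrm{convhull}\left((0,0),\left(1+\tfrac{1}{l},0\right),\left(0,(l+1)(k+1)\right)\right)\subseteq\mathbb{R}^2.$$ ''Sharp'' means that for all such $k,l$ the bound is attained by some rational polygon with denominator $l$ and exactly $k$ interior integral points. *)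

(* Defs.v *)
From HB Require Import structures.
From mathcomp Require Import all_boot all_order all_algebra.
From mathcomp Require Import all_classical all_reals all_analysis.

Set Implicit Arguments.
Unset Strict Implicit.
Unset Printing Implicit Defensive.

Import Order.TTheory GRing.Theory Num.Theory.
Import numFieldNormedType.Exports.

Local Open Scope classical_set_scope.
Local Open Scope ring_scope.

(* [R^o] is [R] viewed as a module over itself; it gives the product its
   R-module structure. *)
Notation plane R := (R^o * R^o)%type.

Section RationalPolygons.
Variable R : realType.
Implicit Types (A P : set (plane R)) (k l m : nat).

Definition convhull A : set (plane R) := smallest (@convex_set R (plane R)) A.

(* A convex polygon is nondegenerate here: "two-dimensional" is rendered by the
   interior being nonempty. *)
Definition convex_polygon P : Prop :=
  (exists2 A, finite_set A & P = convhull A) /\ P° !=set0.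

(* Vertices are extreme points: they lie in the relative interior of no
   nondegenerate segment contained in [P]. *)
Definition vertices P : set (plane R) :=
  [set x | P x /\ forall (y z : plane R) (t : R), P y -> P z -> 0 < t < 1 ->
     x = t *: y + (1 - t) *: z -> y = z].

Definition integral_points : set (plane R) :=
  [set x | (x.1 : R) \is a Num.int /\ (x.2 : R) \is a Num.int].

Definition rational_points : set (plane R) :=
  [set x | range (@ratr R) x.1 /\ range (@ratr R) x.2].

Definition rational_polygon P : Prop :=
  convex_polygon P /\ vertices P `<=` rational_points.

Definition dilate l P : set (plane R) :=
  [set (l%:R : R) *: x | x in P].

Definition integral_dilation P l : Prop :=
  vertices (dilate l P) `<=` integral_points.

Definition has_denominator P l : Prop :=
  [/\ (0 < l)%N, integral_dilation P l &
      forall m, (0 < m)%N -> integral_dilation P m -> (l <= m)%N].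

Definition interior_integral_points P : set (plane R) :=
  P° `&` integral_points.

Definition area P : \bar R :=
  (@lebesgue_measure R \x @lebesgue_measure R)%E (P : set (R * R)).

Definition T_triangle k l : set (plane R) :=
  convhull [set ((0, 0) : plane R);
                ((1 + l%:R^-1, 0) : plane R);
                ((0, (l%:R + 1) * (k%:R + 1)) : plane R)].

End RationalPolygons.

Arguments T_triangle : clear implicits.

(* Main.v *)
(* Apply shears and the swap of coordinates (a Euclidean algorithm on integral
   forms) until the lattice width w of P is attained by the first coordinate, and
   let h(x) be the length of the vertical slice of P at x: a concave function on
   [a, b] with b - a = w.  A vertical chord longer than n contains at least n
   interior lattice points, so the integral slices x = 1, ..., m satisfy
   h(j) <= f(j) + 1 with f(1) + ... + f(m) <= k; the denominator l forces the end
   pieces 1 - a and b - m to be at least 1/l.  Summing supporting-line bounds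
   around the integral slices bounds the area by h(1) + ... + h(m) plus two end
   corrections.  If m <= 2 this gives the bound directly.  If m >= 3, minimality
   of the width yields chords of length almost w/2, hence by concavity many slices
   with f(j) >= 1 or f(j) >= 2, which makes k large compared with m. *)

(* The one-slice case is the sharp one: the extremal triangle meets the interior lattice only on x =
   1, where its slice has length k + 1, and its end pieces have lengths 1 and 1/l. With m slices,
   the unit windows centred at the integers contribute up to k + m, because a slice may exceed its
   number of points by 1. The obstacle is that this m and the end corrections must be paid for by
   (ratio l - 1) k + ratio l. For large m the forced points number about 2m, which is enough. For
   small m the room is narrow, tightest at k = 2, and this is what causes the case distinctions and
   the numerical constants. Denominator 2 is treated apart: its ratio 9/4 is too small for end
   estimates that are uniform in a and b, but there a and b are half-integers, so each end piece has
   length exactly 1/2 or 1. *)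
Require Import Defs.
From mathcomp Require Import all_boot all_order all_algebra.
From mathcomp Require Import all_classical all_reals all_analysis.
From mathcomp Require Import measurable_realfun.
From mathcomp Require Import zify ring lra.

Import Order.TTheory GRing.Theory Num.Theory.
Import numFieldNormedType.Exports.

Local Open Scope classical_set_scope.
Local Open Scope card_scope.
Local Open Scope ring_scope.

(** * Concave slice lengths *)

(* [h x] stands for the length of the slice of a convex body at abscissa [x], and
   [ar u v A] for "the part of the body over [u, v] has area at most [A]"; the
   estimates use nothing else about areas. *)
Record profile {R : realType} (a b : R) (h : R -> R) (ar : R -> R -> R -> Prop)
  : Prop := Profile {
  profile_lt : a < b;
  profile_ge0 : forall x, a <= x <= b -> 0 <= h x;
  profile_concave : forall x y z, a <= x -> x <= y -> y <= z -> z <= b ->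
    (z - y) * h x + (y - x) * h z <= (z - x) * h y;
  profile_cat : forall u v w A B, u <= v -> v <= w ->
    ar u v A -> ar v w B -> ar u w (A + B);
  profile_lin : forall u v e c d, a <= u -> u <= v -> v <= b ->
    (forall x, u <= x <= v -> h x <= c + d * (x - e)) ->
    ar u v ((v - u) * (c + d * ((u + v) / 2 - e)));
  profile_mono : forall u v A B, A <= B -> ar u v A -> ar u v B }.

Arguments profile_lt {R a b h ar}.
Arguments profile_ge0 {R a b h ar}.
Arguments profile_concave {R a b h ar}.
Arguments profile_cat {R a b h ar}.
Arguments profile_lin {R a b h ar}.
Arguments profile_mono {R a b h ar}.

Section Profile.
Context {R : realType}.
Implicit Types (a b t u v x y z : R) (h : R -> R) (ar : R -> R -> R -> Prop).

(** Lets every estimate made at the left end serve at the right end. *)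
Lemma profile_rev t a b h ar : profile a b h ar ->
  profile (t - b) (t - a) (fun x => h (t - x)) (fun u v => ar (t - v) (t - u)).
Proof.
case=> ab h0 hc hcat hlin hmono; split.
- lra.
- by move=> x xab; apply: h0; lra.
- move=> x y z ax xy yz zb.
  have := hc (t - z) (t - y) (t - x).
  by move=> /(_ ltac:(lra) ltac:(lra) ltac:(lra) ltac:(lra)); lra.
- move=> u v w A B uv vw Auv Avw.
  by rewrite (addrC A); apply: (hcat _ (t - v)) => //; lra.
- move=> u v e c d au uv vb H.
  have := hlin (t - v) (t - u) (t - e) c (- d).
  move=> /(_ ltac:(lra) ltac:(lra) ltac:(lra)) /(_ _)/hmono; apply; last first.
    move=> x xuv; have := H (t - x) ltac:(lra).
    by rewrite subKr; lra.
  lra.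
- by move=> u v A B AB; apply: hmono.
Qed.

Lemma profile_support {a b h ar} : profile a b h ar -> forall y, a < y < b ->
  exists s, forall x, a <= x <= b -> h x <= h y + s * (x - y).
Proof.
move=> P y /andP[ay yb].
(* The slope will be the right derivative at [y], the supremum of the secant slopes to the right;
   [key] says that these never exceed a secant slope to the left. *)
pose E := [set s | exists2 x, y < x <= b & s = (h x - h y) / (x - y)].
have E0 : E !=set0 by exists ((h b - h y) / (b - y)); exists b => //; lra.
have key x z : a <= x < y -> y < z <= b ->
    (h z - h y) / (z - y) <= (h y - h x) / (y - x).
  move=> xy yz; rewrite ler_pdivrMr; last lra.
  rewrite mulrAC ler_pdivlMr; last lra.
  have := profile_concave P x y z.
  by move=> /(_ ltac:(lra) ltac:(lra) ltac:(lra) ltac:(lra)); lra.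
have Eub : has_ubound E.
  exists ((h y - h a) / (y - a)) => _ [z zy ->].
  by apply: key => //; lra.
exists (sup E) => x xab; case: (ltgtP x y) => [xy|yx|->].
- have : sup E <= (h y - h x) / (y - x).
    by apply: ge_sup => // _ [z zy ->]; apply: key => //; lra.
  by rewrite ler_pdivlMr; lra.
- have : (h x - h y) / (x - y) <= sup E.
    by apply: ub_le_sup => //; exists x => //; lra.
  by rewrite ler_pdivrMr; lra.
- by rewrite subrr mulr0 addr0.
Qed.

(** Midpoint rule: a line supporting [h] at [y] has mean [h y] over an interval centred at [y],
    whatever its slope. *)
Lemma profile_window {a b h ar} : profile a b h ar -> forall y r, 0 < r ->
  a <= y - r -> y + r <= b -> ar (y - r) (y + r) (2 * r * h y).
Proof.
move=> P y r r0 ar' rb.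
have [s Hs] := profile_support P y ltac:(lra).
have /= := profile_lin P (y - r) (y + r) y (h y) s ar' ltac:(lra) rb.
move=> /(_ _)/(profile_mono P); apply; last first.
  by move=> x xr; apply: Hs; lra.
by lra.
Qed.

(* The line supporting [h] at [y] stays above [h >= 0] at [2 * y - u], so its
   mass on [u, v] is at most that of the window centred at [y]. *)
Lemma profile_half_window {a b h ar} : profile a b h ar -> forall y u v,
  a <= u -> u < y -> y <= v -> v <= 2 * y - u -> 2 * y - u <= b ->
  ar u v (2 * (y - u) * h y).
Proof.
move=> P y u v au uy yv vyu yub.
have [s Hs] := profile_support P y ltac:(lra).
have /= := profile_lin P u v y (h y) s au ltac:(lra) ltac:(lra).
move=> /(_ _)/(profile_mono P); apply; last first.
  by move=> x xr; apply: Hs; lra.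
have H1 := Hs (2 * y - u) ltac:(lra).
have H1' := profile_ge0 P (2 * y - u) ltac:(lra).
have H2 := Hs v ltac:(lra).
have H2' := profile_ge0 P v ltac:(lra).
have : 0 <= (2 * y - u - v) * ((h y + s * (2 * y - u - y)) + (h y + s * (v - y))).
  by apply: mulr_ge0; lra.
by lra.
Qed.

End Profile.

(** * Counting points on runs of consecutive slices *)

Section SliceCount.
Local Open Scope nat_scope.
Context (m : nat).
Implicit Types (f : nat -> nat) (i j p q N M : nat).

Lemma leq_sum_window p N : 0 < p -> p + N <= m.+1 ->
  N <= \sum_(1 <= j < m.+1) (p <= j < p + N).
Proof.
move=> p0 pN.
rewrite (@big_cat_nat _ _ _ p)//=; last by lia.
rewrite (@big_cat_nat _ _ _ (p + N) p)//=; last by lia.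
rewrite addnCA; apply: leq_trans (leq_addr _ _).
rewrite (eq_big_nat _ _ (F2 := fun=> 1)); last by move=> j ->.
by rewrite sum_nat_const_nat addKn muln1.
Qed.

Lemma sum_delta i c : 0 < i <= m -> \sum_(1 <= j < m.+1) (j == i) * c = c.
Proof.
move=> im; rewrite (bigD1_seq i) ?mem_index_iota ?iota_uniq//= eqxx mul1n.
by rewrite big1 ?addn0// => j /negPf ->.
Qed.

(** Layer counting: [f] dominates the sum of the indicators of the two windows, even where they
    overlap, since there [2 <= f j]. *)
Lemma windows_le_sum f p N q M :
  0 < p -> p + N <= m.+1 -> 0 < q -> q + M <= m.+1 ->
  (forall j, p <= j < p + N -> 1 <= f j) ->
  (forall j, q <= j < q + M -> 2 <= f j) ->
  N + M <= \sum_(1 <= j < m.+1) f j.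
Proof.
move=> p0 pN q0 qM f1 f2.
apply: leq_trans (leq_add (leq_sum_window _ _ p0 pN) (leq_sum_window _ _ q0 qM)) _.
rewrite -big_split/= leq_sum// => j _.
have := f1 j; have := f2 j.
by case: (p <= j < p + N); case: (q <= j < q + M) => //=; lia.
Qed.

(** Away from [i] and [j] the window keeps at least N - 2 indices, each with at least one point;
    hence the 2 on the right. *)
Lemma window_pair_le_sum f p N i j :
  0 < p -> p + N <= m.+1 -> 0 < i <= m -> 0 < j <= m -> i != j ->
  (forall t, p <= t < p + N -> 1 <= f t) ->
  N + f i + f j <= (\sum_(1 <= t < m.+1) f t).+2.
Proof.
move=> p0 pN im jm ij f1.
have Ei := sum_delta i 1 im; have Ej := sum_delta j 1 jm.
have Fi := sum_delta i (f i) im; have Fj := sum_delta j (f j) jm.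
have W := leq_sum_window _ _ p0 pN.
suff : \sum_(1 <= t < m.+1) ((p <= t < p + N) + (t == i) * f i + (t == j) * f j) <=
       \sum_(1 <= t < m.+1) (f t + (t == i) * 1 + (t == j) * 1).
  by rewrite !big_split/= Ei Ej Fi Fj; lia.
rewrite leq_sum// => t _.
have := f1 t; case: (eqVneq t i) => [->|ti].
  by rewrite (negPf ij); case: (p <= i < p + N) => //=; lia.
by case: (eqVneq t j) => [->|tj]; case: (p <= _ < p + N) => //=; lia.
Qed.

Lemma window_one_le_sum f p N i :
  0 < p -> p + N <= m.+1 -> 0 < i <= m ->
  (forall t, p <= t < p + N -> 1 <= f t) ->
  N + f i <= (\sum_(1 <= t < m.+1) f t).+1.
Proof.
move=> p0 pN im f1.
have Ei := sum_delta i 1 im.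
have Fi := sum_delta i (f i) im.
have W := leq_sum_window _ _ p0 pN.
suff : \sum_(1 <= t < m.+1) ((p <= t < p + N) + (t == i) * f i) <=
       \sum_(1 <= t < m.+1) (f t + (t == i) * 1).
  by rewrite !big_split/= Ei Fi; lia.
rewrite leq_sum// => t _.
have := f1 t; case: (eqVneq t i) => [->|ti];
  by case: (p <= _ < p + N) => //=; lia.
Qed.

End SliceCount.

(** Equal to (1 + s)^2 / (2 s) at s = 1/l: the area over [0, 1 + s] under the line that vanishes at
    1 + s and has height 1 at 1. Thus [ratio l * (k + 1)] is the area of the extremal triangle. *)
Definition ratio {R : realType} (l : R) : R := (l + 1) ^+ 2 / (2 * l).

(** * One or two integral slices *)

Section Small.
Context {R : realType}.
Implicit Types (a b t u v x y z l : R) (h : R -> R) (ar : R -> R -> R -> Prop).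

Lemma ratioE l : 0 < l -> ratio l = l / 2 + 1 + l^-1 / 2.
Proof. by move=> l0; rewrite /ratio; field; lra. Qed.

Lemma invr_bounds l n : 0 < n -> n <= l -> 0 < l^-1 <= n^-1.
Proof.
by move=> n0 nl; rewrite invr_gt0 lef_pV2 ?posrE ?nl ?andbT//; lra.
Qed.

(** To the right of [j], [h] stays below the line from (a, 0) through (j, h j). The window at [j]
    and the remainder under that line add up to the triangle under the line over [a, b], which is
    largest for end pieces 1/l and 1. *)
Lemma profile_one_slice_aux {a b h ar} : profile a b h ar ->
  forall j l K, a < j -> j < b -> 2 <= l -> 1 <= l * (j - a) ->
  j - a <= b - j -> b - j <= 1 -> h j <= K ->
  ar a b (ratio l * K).
Proof.
move=> P j l K aj jb l2 la ab b1 hK.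
have h0 := profile_ge0 P j ltac:(lra).
have W := profile_window P j (j - a) ltac:(lra) ltac:(lra) ltac:(lra).
rewrite (_ : j - (j - a) = a) in W; last by ring.
have X : forall x, j + (j - a) <= x <= b ->
    h x <= h j + h j / (j - a) * (x - j).
  move=> x xb; 
  rewrite (mulrAC (h j)) -lerBlDl ler_pdivlMr; last lra.
  have H := profile_concave P a j x ltac:(lra) ltac:(lra) ltac:(lra) ltac:(lra).
  have Ha := profile_ge0 P a ltac:(lra).
  have : 0 <= (x - j) * h a by apply: mulr_ge0; lra.
  by lra.
have Y := profile_lin P (j + (j - a)) b _ _ _ ltac:(lra) ltac:(lra) ltac:(lra) X.
have := profile_cat P a (j + (j - a)) b _ _ ltac:(lra) ltac:(lra) W Y.
apply: (profile_mono P).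
set al := j - a in la ab X W Y *; set be := b - j in ab b1 *.
rewrite [leLHS](_ : _ = h j * ((al + be) ^+ 2 / (2 * al))); last first.
  rewrite /al /be; field; lra.
rewrite mulrC ler_pM//; first by rewrite divr_ge0 ?sqr_ge0//; rewrite /al; lra.
have al0 : 0 < al by rewrite /al; lra.
rewrite /ratio ler_pdivrMr; last lra.
rewrite mulrAC ler_pdivlMr; last lra.
have : (al + be) ^+ 2 * l <= (al + 1) ^+ 2 * l.
  by rewrite ler_pM2r ?lerXn2r ?nnegrE; lra.
(* This says that al + 1/al is at most l + 1/l, because al lies between 1/l and l. *)
have : 0 <= (l - al) * (l * al - 1) by apply: mulr_ge0; lra.
clearbody al be; clear; lra.
Qed.

Lemma profile_one_slice {a b h ar} : profile a b h ar ->
  forall j l K, a < j -> j < b -> 2 <= l -> 1 <= l * (j - a) ->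
  1 <= l * (b - j) -> j - a <= 1 -> b - j <= 1 -> h j <= K ->
  ar a b (ratio l * K).
Proof.
move=> P j l K aj jb l2 la lb a1 b1 hK.
case: (lerP (j - a) (b - j)) => [ab|ba]; first exact: profile_one_slice_aux hK.
have P' := profile_rev (2 * j) _ _ _ _ P.
have := profile_one_slice_aux P' j l K.
rewrite (_ : 2 * j - (2 * j - b) = b); last ring.
rewrite (_ : 2 * j - (2 * j - a) = a); last ring.
rewrite (_ : 2 * j - j = j); last ring.
by apply => //; lra.
Qed.

(** The line from (a, 0) through (1, h 1) acts as a lever, as in the one-slice case. With s = 1 - a
    the factor is (s + 1/2)^2 / (2 s), decreasing for s up to 1/2; the constant is its value at s =
    1/l. *)
Lemma profile_end_lever {a b h ar} : profile a b h ar ->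
  forall l, 2 <= l -> 1 <= l * (1 - a) -> 1 / 2 <= a -> 3 / 2 <= b ->
  ar a (3 / 2) ((1 + l / 4 + l^-1) / 2 * h 1).
Proof.
move=> P l l2 la a2 b2.
have a1 : a < 1 by rewrite -subr_gt0 -(pmulr_rgt0 _ (_ : 0 < l)); lra.
have h0 := profile_ge0 P 1 ltac:(lra).
have W := profile_window P 1 (1 - a) ltac:(lra) ltac:(lra) ltac:(lra).
rewrite (_ : 1 - (1 - a) = a) in W; last by ring.
have X : forall x, 1 + (1 - a) <= x <= 3 / 2 ->
    h x <= h 1 + h 1 / (1 - a) * (x - 1).
  move=> x xb; rewrite (mulrAC (h 1)) -lerBlDl ler_pdivlMr; last lra.
  have H := profile_concave P a 1 x ltac:(lra) ltac:(lra) ltac:(lra) ltac:(lra).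
  have Ha := profile_ge0 P a ltac:(lra).
  have : 0 <= (x - 1) * h a by apply: mulr_ge0; lra.
  by lra.
have Y := profile_lin P (1 + (1 - a)) (3 / 2) _ _ _
  ltac:(lra) ltac:(lra) ltac:(lra) X.
have := profile_cat P a (1 + (1 - a)) (3 / 2) _ _
  ltac:(lra) ltac:(lra) W Y.
apply: (profile_mono P).
rewrite [leLHS](_ : _ = ((1 - a) + 1 / 2) ^+ 2 / (2 * (1 - a)) * h 1); last first.
  by field; lra.
rewrite ler_wpM2r// ler_pdivrMr; last lra.
have li : l * l^-1 = 1 by rewrite mulfV; lra.
have l0 : 0 < l^-1 by rewrite invr_gt0; lra.
have : 0 <= (l - 4 * (1 - a)) * (l * (1 - a) - 1) * l^-1.
  by rewrite !mulr_ge0; lra.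
have -> : (l - 4 * (1 - a)) * (l * (1 - a) - 1) * l^-1 =
   (l * l^-1) * l * (1 - a) - l * l^-1 - 4 * (1 - a) ^+ 2 * (l * l^-1) +
   4 * (1 - a) * l^-1 by ring.
by rewrite li; lra.
Qed.

(** The window at 1 covers [1/2, 3/2]; left of it, [h] lies below the extension of the chord through
    the slices at 1 and 2. *)
Lemma profile_end_full {a b h ar} : profile a b h ar ->
  0 <= a -> a <= 1 / 2 -> 2 <= b ->
  ar a (3 / 2)
    (h 1 + (1 / 2 - a) * (h 1 + (h 1 - h 2) * (3 / 2 - a) / 2)).
Proof.
move=> P a0 a2 b2.
have W := profile_window P 1 (1 / 2) ltac:(lra) ltac:(lra) ltac:(lra).
have X : forall x, a <= x <= 1 / 2 -> h x <= h 1 + (h 2 - h 1) * (x - 1).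
  move=> x xa.
  have H := profile_concave P x 1 2 ltac:(lra) ltac:(lra) ltac:(lra) ltac:(lra).
  by lra.
have Y := profile_lin P a (1 / 2) _ _ _
  ltac:(lra) ltac:(lra) ltac:(lra) X.
rewrite (_ : 1 - 1 / 2 = 1 / 2) in W; last by field.
rewrite (_ : 1 + 1 / 2 = 3 / 2) in W; last by field.
have := profile_cat P a (1 / 2) (3 / 2) _ _
  ltac:(lra) ltac:(lra) Y W.
by apply: (profile_mono P); lra.
Qed.

(** Bounds the part beyond the window in [profile_end_full], with t = 1/2 - a. The worst case is t =
    1/2, that is a = 0; a nonnegative [d] covers the case where the slices grow inwards. *)
Lemma end_excess_le (x y d t : R) : 0 <= t <= 1 / 2 -> 0 <= x -> 0 <= d ->
  x - y <= d ->
  t * (x + (x - y) * (t + 1) / 2) <= x / 2 + 3 / 8 * d.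
Proof.
move=> t01 x0 d0 xyd.
have : 0 <= t * (t + 1) * (d - (x - y)) by rewrite !mulr_ge0; lra.
have : 0 <= (1 / 2 - t) * x by rewrite mulr_ge0; lra.
have : 0 <= (1 / 2 - t) * (t + 3 / 2) * d by rewrite !mulr_ge0; lra.
by lra.
Qed.

Lemma ratio_ge l : 2 <= l -> 9 / 4 <= ratio l.
Proof.
move=> l2; rewrite ratioE; last lra.
have : 0 <= (l - 2) * (l - 1 / 2) * l^-1.
  by rewrite !mulr_ge0 ?invr_ge0; lra.
rewrite (_ : _ * l^-1 = l + l^-1 - 5 / 2); last by field; lra.
lra.
Qed.

Lemma lever_le_ratio l : 2 <= l ->
  (1 + l / 4 + l^-1) / 2 <= ratio l - 5 / 4 /\
  (1 + l / 4 + l^-1) / 2 <= 3 / 4 * ratio l.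
Proof.
move=> l2; have := invr_bounds l 2 ltac:(lra) l2.
by rewrite ratioE; [split; lra|lra].
Qed.

(** The total is at most c (k + 2), hence at most 3/4 r (k + 2), and 3 (k + 2) <= 4 (k + 1) amounts
    to k >= 2. *)
Lemma ratio_two_levers (r c x y k k1 k2 : R) : 9 / 4 <= r -> c <= 3 / 4 * r ->
  0 <= c -> k1 + k2 <= k -> 2 <= k -> x <= k1 + 1 -> y <= k2 + 1 ->
  c * x + c * y <= r * (k + 1).
Proof.
move=> r94 cr c0 kk k2' hx hy.
have : 0 <= c * (k + 2 - x - y) by rewrite mulr_ge0; lra.
have : 0 <= (3 / 4 * r - c) * (k + 2) by rewrite mulr_ge0; lra.
have : 0 <= (r - 9 / 4) * (k - 2) by rewrite mulr_ge0; lra.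
move: k2' r94; clear; lra.
Qed.

(** Here 15/8 = 1 + 1/2 + 3/8 is the worst factor of a full end, with the neighbouring slice
    estimated by 0. *)
Lemma ratio_lever_full (r c x y k k1 k2 : R) : 9 / 4 <= r -> c <= r - 5 / 4 ->
  0 <= c -> 0 <= k1 -> 0 <= k2 -> k1 + k2 <= k -> 2 <= k ->
  x <= k1 + 1 -> y <= k2 + 1 ->
  c * x + 15 / 8 * y <= r * (k + 1).
Proof.
move=> r94 cr c0 k10 k20 kk k2' hx hy.
have : 0 <= c * (k1 + 1 - x) by rewrite mulr_ge0; lra.
have : 0 <= (r - 5 / 4 - c) * (k1 + 1) by rewrite mulr_ge0; lra.
have : 0 <= (r - 9 / 4) * (k - k1) by rewrite mulr_ge0; lra.
move: hx hy k10 k20 kk k2' r94; clear; lra.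
Qed.

Lemma profile_two_slices_aux {a b h ar} : profile a b h ar ->
  forall l k k1 k2, 2 <= l -> 0 <= a -> 1 <= l * (1 - a) -> 1 <= l * (b - 2) ->
  2 < b -> b <= 3 ->
  h 1 <= k1 + 1 -> h 2 <= k2 + 1 -> 0 <= k1 -> 0 <= k2 -> k1 + k2 <= k -> 2 <= k ->
  1 / 2 <= a ->
  ar a b (ratio l * (k + 1)).
Proof.
move=> P l k k1 k2 l2 a0 la lb b2 b3 h1 h2 k10 k20 kk kge2 a2.
have l0 := invr_bounds l 2 ltac:(clear -l2; lra) l2.
have c0 : 0 <= (1 + l / 4 + l^-1) / 2 by clear -l2 l0; lra.
have [c1 c2] := lever_le_ratio _ l2.
have arith1 := ratio_two_levers _ _ _ _ _ _ _ (ratio_ge _ l2) c2 c0 kk kge2 h1 h2.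
have arith2 := ratio_lever_full _ _ _ _ _ _ _ (ratio_ge _ l2) c1 c0 k10 k20 kk
  kge2 h1 h2.
have P' := profile_rev 3 _ _ _ _ P.
have a1 : a < 1 by rewrite -subr_gt0 -(pmulr_rgt0 _ (_ : 0 < l)); clear -la l2; lra.
have A := profile_end_lever P l l2 la a2 ltac:(clear -b2; lra).
have e1 : 3 - 3 / 2 = 3 / 2 :> R by field.
have e2 : 3 - (3 - b) = b by ring.
have e3 : 3 - 1 = 2 :> R by ring.
have e4 : 3 - 2 = 1 :> R by ring.
have cat B1 B2 := profile_cat P a (3 / 2) b B1 B2
  ltac:(clear -a1; lra) ltac:(clear -b2; lra).
have h10 := profile_ge0 P 1 ltac:(clear -a1 b2; lra).
have h20 := profile_ge0 P 2 ltac:(clear -a1 b2 b3; lra).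
case: (leP (1 / 2) (3 - b)) => b12.
- have := profile_end_lever P' l l2 ltac:(clear -lb; lra) b12
    ltac:(clear -a1; lra).
  rewrite e1 e2 e3 => B.
  by apply: (profile_mono P) (cat _ _ A B).
- have := profile_end_full P' ltac:(clear -b3; lra) ltac:(clear -b12; lra)
    ltac:(clear -a1; lra).
  rewrite e1 e2 e3 e4 => B.
  apply: (profile_mono P) (cat _ _ A B).
  apply: le_trans arith2; rewrite lerD2l.
  have := end_excess_le (h 2) (h 1) (h 2) (b - 5 / 2)
    ltac:(clear -b12 b3; lra) h20 h20 ltac:(clear -h10; lra).
  by clear; lra.
Qed.

Lemma profile_two_slices {a b h ar} : profile a b h ar ->
  forall l k k1 k2, 2 <= l -> 0 <= a -> 1 <= l * (1 - a) -> 1 <= l * (b - 2) ->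
  2 < b -> b <= 3 ->
  h 1 <= k1 + 1 -> h 2 <= k2 + 1 -> 0 <= k1 -> 0 <= k2 -> k1 + k2 <= k -> 2 <= k ->
  ar a b (ratio l * (k + 1)).
Proof.
move=> P l k k1 k2 l2 a0 la lb b2 b3 h1 h2 k10 k20 kk kge2.
have P' := profile_rev 3 _ _ _ _ P.
have e1 : 3 - 3 / 2 = 3 / 2 :> R by field.
have e2 : 3 - (3 - b) = b by ring.
have e5 : 3 - (3 - a) = a by ring.
have e3 : 3 - 1 = 2 :> R by ring.
have e4 : 3 - 2 = 1 :> R by ring.
have a1 : a < 1 by rewrite -subr_gt0 -(pmulr_rgt0 _ (_ : 0 < l)); clear -la l2; lra.
case: (leP (1 / 2) a) => a2; first exact: (profile_two_slices_aux P l k k1 k2).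
case: (leP (1 / 2) (3 - b)) => b12.
  have := profile_two_slices_aux P' l k k2 k1.
  rewrite e2 e5 e3 e4; apply => //; last by rewrite addrC.
  - by clear -b3; lra.
  - by clear -lb; lra.
  - by clear -la; lra.
  - by clear -a1; lra.
  - by clear -a0; lra.
have A := profile_end_full P ltac:(clear -a0; lra) ltac:(clear -a2; lra)
  ltac:(clear -b2; lra).
have := profile_end_full P' ltac:(clear -b3; lra) ltac:(clear -b12; lra)
  ltac:(clear -a1; lra).
rewrite e1 e2 e3 e4 => B.
have := profile_cat P a (3 / 2) b _ _
  ltac:(clear -a1; lra) ltac:(clear -b2; lra) A B.
apply: (profile_mono P).
have h10 := profile_ge0 P 1 ltac:(clear -a1 b2; lra).
have h20 := profile_ge0 P 2 ltac:(clear -a1 b2 b3; lra).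
apply: (@le_trans _ _ (9 / 4 * (k + 1))); last first.
  by rewrite ler_wpM2r ?ratio_ge//; clear -kge2; lra.
have ta : 0 <= 1 / 2 - a <= 1 / 2 by clear -a0 a2; lra.
have tb : 0 <= b - 5 / 2 <= 1 / 2 by clear -b3 b12; lra.
clear -h10 h20 ta tb h1 h2 kge2 kk k10 k20.
(* Both ends are full. The extrapolation term can be positive only at the longer slice, so the other
   end takes [d = 0] and the difference of the slices counts once. *)
case: (leP (h 1) (h 2)) => h12.
- have := end_excess_le (h 1) (h 2) 0 _ ta h10 (lexx _) ltac:(clear -h12; lra).
  have := end_excess_le (h 2) (h 1) (h 2 - h 1) _ tb h20
    ltac:(clear -h12; lra) (lexx _).
  by move: h10 h20 h1 h2 kge2 kk k10 k20; clear; lra.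
- have := end_excess_le (h 1) (h 2) (h 1 - h 2) _ ta h10
    ltac:(clear -h12; lra) (lexx _).
  have := end_excess_le (h 2) (h 1) 0 _ tb h20 (lexx _) ltac:(clear -h12; lra).
  by move: h10 h20 h1 h2 kge2 kk k10 k20; clear; lra.
Qed.

End Small.

(** * Level sets of a concave profile *)

Section Levels.
Context {R : realType}.
Implicit Types (a b t u v x y z l : R) (h : R -> R) (ar : R -> R -> R -> Prop).

(* [h] exceeds the height [i] on an interval of length [(b - a) * (1 - i / t)]
   as soon as it exceeds [t] somewhere. *)
Lemma profile_level {a b h ar} : profile a b h ar -> forall (m : nat) i x0 t (N : nat),
  0 <= a -> b <= m%:R + 1 -> 0 < i -> a <= x0 <= b -> t < h x0 ->
  i < t -> N%:R * t < (b - a) * (t - i) ->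
  exists p : nat, [/\ (0 < p)%N, (p + N <= m.+1)%N &
    forall j : nat, (p <= j < p + N)%N -> i < h j%:R].
Proof.
move=> P m i x0 t N a0 bm i0 x0ab th it Nt.
have t0 : 0 < t by lra.
(* By concavity [h] lies above the tent with feet (a, 0), (b, 0) and apex (x0, t); [c] and [d] are
   the abscissas where the tent crosses height [i]. *)
pose c := x0 - (x0 - a) * (t - i) / t.
pose d := x0 + (b - x0) * (t - i) / t.
have dc : N%:R < d - c.
  rewrite (_ : d - c = (b - a) * (t - i) / t); last by rewrite /d /c; field; lra.
  by rewrite ltr_pdivlMr.
have cx : c <= x0.
  by rewrite /c gerBl divr_ge0 ?mulr_ge0; lra.
have xd : x0 <= d.
  by rewrite /d lerDl divr_ge0 ?mulr_ge0; lra.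
have ac : a <= c.
  rewrite -subr_ge0 (_ : c - a = (x0 - a) * i / t); last by rewrite /c; field; lra.
  by rewrite divr_ge0 ?mulr_ge0; lra.
have db : d <= b.
  rewrite -subr_ge0 (_ : b - d = (b - x0) * i / t); last by rewrite /d; field; lra.
  by rewrite divr_ge0 ?mulr_ge0; lra.
have lev y : c <= y <= d -> i < h y.
  have [yx|xy|->] := ltgtP y x0; last by move=> _; lra.
  - move=> /andP[cy _].
    have H := profile_concave P a y x0 ltac:(lra) ltac:(lra) ltac:(lra) ltac:(lra).
    have Ha := profile_ge0 P a ltac:(lra).
    have H1 : 0 <= (x0 - y) * h a by rewrite mulr_ge0; lra.
    have H2 : (x0 - a) * i <= (y - a) * t.
      have : 0 <= (y - c) * t by rewrite mulr_ge0; lra.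
      rewrite (_ : (y - c) * t = (y - a) * t - (x0 - a) * i); first lra.
      by rewrite /c; field; lra.
    have H3 : (y - a) * t < (y - a) * h x0.
      rewrite ltr_pM2l// subr_gt0 lt_neqAle; apply/andP; split; last lra.
      apply/eqP => ay; move: H2; rewrite -ay subrr mul0r.
      have : 0 < (x0 - a) * i by rewrite mulr_gt0; lra.
      by lra.
    have : (x0 - a) * i < (x0 - a) * h y by lra.
    by rewrite ltr_pM2l; lra.
  - move=> /andP[_ yd].
    have H := profile_concave P x0 y b ltac:(lra) ltac:(lra) ltac:(lra) ltac:(lra).
    have Ha := profile_ge0 P b ltac:(lra).
    have H1 : 0 <= (y - x0) * h b by rewrite mulr_ge0; lra.
    have H2 : (b - x0) * i <= (b - y) * t.
      have : 0 <= (d - y) * t by rewrite mulr_ge0; lra.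
      rewrite (_ : (d - y) * t = (b - y) * t - (b - x0) * i); first lra.
      by rewrite /d; field; lra.
    have H3 : (b - y) * t < (b - y) * h x0.
      rewrite ltr_pM2l// subr_gt0 lt_neqAle; apply/andP; split; last lra.
      apply/eqP => ay; move: H2; rewrite ay subrr mul0r.
      have : 0 < (b - x0) * i by rewrite mulr_gt0; lra.
      by lra.
    have : (b - x0) * i < (b - x0) * h y by lra.
    by rewrite ltr_pM2l; lra.
have c0 : 0 <= c by lra.
have [/= tc1 tc2] := andP (truncn_itv c0).
(* The first integer to the right of [c]; the N integers from there on are at most c + N < d. *)
exists (Num.truncn c).+1; split => //.
- rewrite addSn -(ltr_nat R) natrD.
  by move: tc1; rewrite -(natr1 m); lra.
- move=> j /andP[j1 j2]; apply: lev.
  have : (Num.truncn c).+1%:R <= j%:R :> R by rewrite ler_nat.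
  have : j%:R <= (Num.truncn c + N)%:R :> R by rewrite ler_nat -ltnS.
  by rewrite natrD -natr1; move: tc1 tc2; rewrite -natr1; lra.
Qed.

End Levels.

(** * Integral slices *)

(* The slices at the integers [1, ..., m] are those that meet the interior of the
   body, and [f j] is a number of interior lattice points on the [j]-th one;
   [slices_peak] is what remains of the minimality of the width [b - a]. *)
Record slices {R : realType} (l : R) (m k : nat) (a b : R) (h : R -> R)
  (ar : R -> R -> R -> Prop) (f : nat -> nat) : Prop := Slices {
  slices_profile : profile a b h ar;
  slices_l : 2 <= l;
  slices_k : (2 <= k)%N;
  slices_a0 : 0 <= a;
  slices_a1 : 1 <= l * (1 - a);
  slices_b0 : 1 <= l * (b - m%:R);
  slices_b1 : b <= m%:R + 1;
  slices_le : forall j, (0 < j <= m)%N -> h j%:R <= (f j)%:R + 1;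
  slices_sum : (\sum_(1 <= j < m.+1) f j <= k)%N;
  slices_peak : forall t, t < (b - a) / 2 -> exists2 x, a <= x <= b & t < h x }.

Arguments slices_profile {R l m k a b h ar f}.
Arguments slices_l {R l m k a b h ar f}.
Arguments slices_k {R l m k a b h ar f}.
Arguments slices_a0 {R l m k a b h ar f}.
Arguments slices_a1 {R l m k a b h ar f}.
Arguments slices_b0 {R l m k a b h ar f}.
Arguments slices_b1 {R l m k a b h ar f}.
Arguments slices_le {R l m k a b h ar f}.
Arguments slices_sum {R l m k a b h ar f}.
Arguments slices_peak {R l m k a b h ar f}.

Section Slices.
Context {R : realType}.
Implicit Types (a b t u v x y z l e : R) (h : R -> R) (ar : R -> R -> R -> Prop)
  (m k : nat) (f : nat -> nat).

Lemma slices_rev {l m k a b h ar f} : slices l m k a b h ar f ->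
  slices l m k (m%:R + 1 - b) (m%:R + 1 - a) (fun x => h (m%:R + 1 - x))
    (fun u v => ar (m%:R + 1 - v) (m%:R + 1 - u)) (fun j => f (m.+1 - j)%N).
Proof.
case=> P l2 k2 a0 a1 b0 b1 hle hsum hpeak; split => //.
- exact: profile_rev.
- by lra.
- by rewrite (_ : 1 - _ = b - m%:R)//; ring.
- by rewrite (_ : _ - m%:R = 1 - a)//; ring.
- by lra.
- move=> j jm; rewrite natr1 -natrB; last by lia.
  by apply: hle; lia.
- rewrite big_nat_rev/= add1n (eq_big_nat _ _ (F2 := f))// => j jm.
  by congr f; lia.
- move=> t tba; have [x xab tx] := hpeak t ltac:(lra).
  by exists (m%:R + 1 - x); [lra|rewrite subKr].
Qed.

Lemma slices_a_lt1 {l m k a b h ar f} : slices l m k a b h ar f -> a < 1.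
Proof.
case=> _ l2 _ _ a1 _ _ _ _ _.
by rewrite -subr_gt0 -(pmulr_rgt0 _ (_ : 0 < l)); lra.
Qed.

Lemma slices_b_gtm {l m k a b h ar f} : slices l m k a b h ar f -> m%:R < b.
Proof.
case=> _ l2 _ _ _ b0 _ _ _ _.
by rewrite -subr_gt0 -(pmulr_rgt0 _ (_ : 0 < l)); lra.
Qed.

Lemma slices_ge0 {l m k a b h ar f} : slices l m k a b h ar f ->
  forall j, (0 < j <= m)%N -> 0 <= h j%:R.
Proof.
move=> S j /andP[j0 jm]; apply: (profile_ge0 (slices_profile S)).
have := slices_a_lt1 S; have := slices_b_gtm S.
have : 1 <= j%:R :> R by rewrite ler1n.
have : j%:R <= m%:R :> R by rewrite ler_nat.
lra.
Qed.

Lemma slices_concave {l m k a b h ar f} : slices l m k a b h ar f ->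
  forall j, (0 < j)%N -> (j.+2 <= m)%N -> h j%:R + h j.+2%:R <= 2 * h j.+1%:R.
Proof.
move=> S j j0 jm.
have a1 := slices_a_lt1 S; have bm := slices_b_gtm S.
have j1 : 1 <= j%:R :> R by rewrite ler1n.
have jm' : j.+2%:R <= m%:R :> R by rewrite ler_nat.
have e1 : j.+1%:R = j%:R + 1 :> R by rewrite natr1.
have e2 : j.+2%:R = j%:R + 2 :> R by rewrite -addn2 natrD.
have := profile_concave (slices_profile S)
  j%:R j.+1%:R j.+2%:R ltac:(lra) ltac:(lra) ltac:(lra) ltac:(lra).
rewrite !{}e1 !{}e2; lra.
Qed.

(** With w = b - a and a peak height t close to w/2, the level set above [i] has length w (1 - i/t),
    close to w - 2 i. A slice longer than [i] carries at least [i] points because [h] is at most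
    [f + 1]. *)
Lemma slices_level {l m k a b h ar f} : slices l m k a b h ar f ->
  forall i N : nat, (0 < i)%N -> N%:R + 2 * i%:R < b - a ->
  exists p : nat, [/\ (0 < p)%N, (p + N <= m.+1)%N,
    forall j : nat, (p <= j < p + N)%N -> i%:R < h j%:R &
    forall j : nat, (p <= j < p + N)%N -> (i <= f j)%N].
Proof.
move=> S i N i0 Nw.
have i1 : 1 <= i%:R :> R by rewrite ler1n.
have N0 : 0 <= N%:R :> R by [].
have l1 : (b - a) * i%:R / (b - a - N%:R) < (b - a) / 2.
  rewrite ltr_pdivrMr; last lra.
  have : 0 < (b - a) * (b - a - N%:R - 2 * i%:R) by rewrite mulr_gt0; lra.
  lra.
(* Halfway between the peak height whose level set has length exactly N and the height (b - a) / 2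
   below which peaks are guaranteed. *)
pose t := ((b - a) * i%:R / (b - a - N%:R) + (b - a) / 2) / 2.
have [x xab tx] := slices_peak S t ltac:(rewrite /t; lra).
have it : i%:R < t.
  apply: (@le_lt_trans _ _ ((b - a) * i%:R / (b - a - N%:R))); last by rewrite /t; lra.
  rewrite ler_pdivlMr; last lra.
  have : 0 <= i%:R * N%:R :> R by rewrite mulr_ge0//; lra.
  lra.
have Nt : N%:R * t < (b - a) * (t - i%:R).
  have : (b - a) * i%:R / (b - a - N%:R) < t by rewrite /t; lra.
  by rewrite ltr_pdivrMr; lra.
have [p [p0 pN H]] := profile_level (slices_profile S) m i%:R x t N
  (slices_a0 S) (slices_b1 S) ltac:(lra) xab tx it Nt.
exists p; split => // j jp.
have := slices_le S j ltac:(lia).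
have := H j jp => h1 h2; rewrite -ltnS -(ltr_nat R) -natr1.
exact: lt_le_trans h2.
Qed.

Lemma profile_windows {a b h ar} : profile a b h ar -> forall p n : nat,
  a <= p%:R - 1 / 2 -> (p + n)%:R - 1 / 2 <= b ->
  ar (p%:R - 1 / 2) ((p + n)%:R - 1 / 2) (\sum_(p <= j < p + n) h j%:R).
Proof.
move=> P p; elim=> [|n IH] ap pb.
  rewrite addn0 big_geq//.
  have := profile_lin P (p%:R - 1 / 2) (p%:R - 1 / 2) (p%:R - 1 / 2)
    (h (p%:R - 1 / 2)) 0 ap (lexx _).
  rewrite addn0 in pb; move=> /(_ pb).
  rewrite (subrr (p%:R - 1 / 2)) mul0r; apply => x xp.
  by rewrite mul0r addr0 (_ : x = p%:R - 1 / 2)//; apply/le_anti; rewrite andbC.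
have e : (p + n.+1)%:R = (p + n)%:R + 1 :> R by rewrite addnS natr1.
rewrite addnS big_nat_recr/=; last by rewrite leq_addr.
have pn : p%:R <= (p + n)%:R :> R by rewrite ler_nat leq_addr.
apply: (profile_cat P _ ((p + n)%:R - 1 / 2)); [lra| |apply: IH => //; lra|].
  by rewrite -addnS; lra.
have := profile_window P (p + n)%:R (1 / 2) ltac:(lra) ltac:(lra) ltac:(lra).
rewrite (_ : 2 * (1 / 2) = 1 :> R) ?mul1r; last by field.
by rewrite (_ : (p + n)%:R + 2^-1 = (p + n).+1%:R - 2^-1)// -natr1; field.
Qed.

(** The window at 1 ends at 2 - a, and slice 2 takes over up to 5/2, for a total of 2 (1 - a) h(1) +
    2 a h(2). Since 1 - a >= 1/l, the excess over h(1) + h(2) can be charged to slice 2 alone. *)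
Lemma profile_lever_two {a b h ar} : profile a b h ar -> forall l,
  2 <= l -> 1 <= l * (1 - a) -> 1 / 2 <= a -> 3 <= b ->
  ar a (5 / 2) (h 1 + h 2 + (1 - 2 / l) * h 2).
Proof.
move=> P l l2 la a2 b3.
have a1 : a < 1 by rewrite -subr_gt0 -(pmulr_rgt0 _ (_ : 0 < l)); lra.
have W1 := profile_window P 1 (1 - a) ltac:(lra) ltac:(lra) ltac:(lra).
have W2 := profile_half_window P 2 (2 - a) (5 / 2)
  ltac:(lra) ltac:(lra) ltac:(lra) ltac:(lra) ltac:(lra).
rewrite (_ : 1 - (1 - a) = a) in W1; last by ring.
rewrite (_ : 1 + (1 - a) = 2 - a) in W1; last by ring.
apply: (profile_mono P) (profile_cat P a (2 - a) (5 / 2) _ _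
  ltac:(lra) ltac:(lra) W1 W2).
have h1 := profile_ge0 P 1 ltac:(lra).
have h2 := profile_ge0 P 2 ltac:(lra).
have : l^-1 <= 1 - a by rewrite -(ler_pM2l (_ : 0 < l)) ?mulfV; lra.
move=> li; have : 0 <= (1 - a - l^-1) * h 2 by rewrite mulr_ge0; lra.
have : 0 <= (2 * a - 1) * h 1 by rewrite mulr_ge0; lra.
by lra.
Qed.

(* Concavity up to [b] bounds the slope of [h] at the left end by
   [h 1 / (b - 1)]. *)
Lemma profile_full_end {a b h ar} : profile a b h ar -> forall c e,
  0 <= a -> a <= 1 / 2 -> 2 <= b -> 0 < c -> c <= b - 1 ->
  (1 / 2 - a) * (1 + (3 / 2 - a) / 2 / c) <= e ->
  ar a (3 / 2) (h 1 + e * h 1).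
Proof.
move=> P c e a0 a2 b2 c0 cb he.
have h1 := profile_ge0 P 1 ltac:(lra).
have hb := profile_ge0 P b ltac:(lra).
apply: (profile_mono P) (profile_end_full P a0 a2 b2).
rewrite lerD2l; apply: (@le_trans _ _
    ((1 / 2 - a) * (1 + (3 / 2 - a) / 2 / c) * h 1)); last by rewrite ler_wpM2r.
rewrite -(mulrA (1 / 2 - a)) ler_wpM2l//; first lra.
rewrite [leRHS]mulrDl mul1r lerD2l.
have H : (h 1 - h 2) * c <= h 1.
  have H := profile_concave P 1 2 b ltac:(lra) ltac:(lra) ltac:(lra) ltac:(lra).
  have [h12|h21] := lerP (h 1) (h 2).
    have : 0 <= (h 2 - h 1) * c by rewrite mulr_ge0; lra.
    lra.
  have : 0 <= (h 1 - h 2) * (b - 1 - c) by rewrite mulr_ge0; lra.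
  lra.
rewrite [leRHS]mulrAC ler_pdivlMr//.
have : 0 <= (3 / 2 - a) / 2 * (h 1 - (h 1 - h 2) * c) by rewrite mulr_ge0; lra.
lra.
Qed.

End Slices.

(** * At least four slices: unit windows plus two end corrections *)

Section ManySlices.
Context {R : realType}.
Implicit Types (a b t u v x y z l e : R) (h : R -> R) (ar : R -> R -> R -> Prop)
  (m k : nat) (f : nat -> nat).

Lemma slices_sum_le {l m k a b h ar f} : slices l m k a b h ar f ->
  \sum_(1 <= j < m.+1) h j%:R <= k%:R + m%:R.
Proof.
move=> S; apply: (@le_trans _ _ (\sum_(1 <= j < m.+1) ((f j)%:R + 1))).
  rewrite big_nat [leRHS]big_nat; apply: ler_sum => j jm.
  by apply: (slices_le S); lia.
rewrite big_split/= lerD//.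
  by rewrite -natr_sum ler_nat (slices_sum S).
by rewrite sumr_const_nat subSS subn0.
Qed.

Lemma sum_ends (F : nat -> R) m : (4 <= m)%N ->
  \sum_(1 <= j < m.+1) F j =
  F 1 + F 2 + \sum_(3 <= j < m.-1) F j + F m.-1 + F m.
Proof.
case: m => [|[|[|[|m]]]]// _; rewrite big_ltn// big_ltn// big_nat_recr//=.
by rewrite big_nat_recr//= !addrA.
Qed.

(** Either kind of end exceeds its windows by at most [e] times one slice bound: slice 2 for a short
    end, slice 1 for a full one. *)
Lemma slices_left_end {l m k a b h ar f} : slices l m k a b h ar f ->
  forall e, (4 <= m)%N -> 1 - 2 / l <= e ->
  (a <= 1 / 2 -> (1 / 2 - a) * (1 + (3 / 2 - a) / 2 / 3) <= e) ->
  exists i : nat, [/\ (0 < i <= 2)%N, i = 2%N -> 1 / 2 <= a &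
    ar a (5 / 2) (h 1 + h 2 + e * ((f i)%:R + 1))].
Proof.
move=> S e m4 le1 le2.
have P := slices_profile S.
have l2 := slices_l S.
have a1 := slices_a_lt1 S.
have b4 : 4 < b.
  by apply: le_lt_trans (slices_b_gtm S); rewrite (ler_nat R 4).
have li : 0 <= 1 - 2 / l by rewrite subr_ge0 ler_pdivrMr; lra.
have e0 : 0 <= e by apply: le_trans le1.
have h1 := slices_ge0 S 1 ltac:(clear -m4; lia); have h2 := slices_ge0 S 2 ltac:(clear -m4; lia).
have f1 := slices_le S 1 ltac:(clear -m4; lia).
have f2 := slices_le S 2 ltac:(clear -m4; lia).
have [a2|a2] := leP (1 / 2) a.
  exists 2; split => //.
  apply: (profile_mono P) (profile_lever_two P l l2
    (slices_a1 S) a2 ltac:(lra)).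
  rewrite lerD2l; apply: le_trans (_ : e * h 2 <= _).
    by rewrite ler_wpM2r.
  by rewrite ler_wpM2l.
exists 1; split => //.
(* The 3 is the lower bound for b - 1 when there are at least four slices. *)
have E := profile_full_end P 3 e (slices_a0 S) (ltW a2) ltac:(lra)
  ltac:(lra) ltac:(lra) (le2 (ltW a2)).
have W := profile_window P 2 (1 / 2) ltac:(lra) ltac:(lra) ltac:(lra).
rewrite (_ : 2 - 1 / 2 = 3 / 2) in W; last by field.
rewrite (_ : 2 + 1 / 2 = 5 / 2) in W; last by field.
apply: (profile_mono P) (profile_cat P a (3 / 2) (5 / 2) _ _
  ltac:(lra) ltac:(lra) E W).
have : 0 <= e * ((f 1)%:R + 1 - h 1) by rewrite mulr_ge0// subr_ge0.
lra.
Qed.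

(** [k + m] bounds the sum of all slice lengths. Having [4 <= m] keeps the end pieces [a, 5/2] and
    [m - 3/2, b] from overlapping. The clause on [i] and [j] records that both ends are then short,
    which limits the width. *)
Lemma slices_total {l m k a b h ar f} : slices l m k a b h ar f ->
  forall e, (4 <= m)%N -> 1 - 2 / l <= e ->
  (a <= 1 / 2 -> (1 / 2 - a) * (1 + (3 / 2 - a) / 2 / 3) <= e) ->
  (m%:R + 1 - b <= 1 / 2 ->
   (1 / 2 - (m%:R + 1 - b)) * (1 + (3 / 2 - (m%:R + 1 - b)) / 2 / 3) <= e) ->
  exists i j : nat, [/\ (0 < i <= 2)%N, (m.-1 <= j <= m)%N,
    i = 2%N -> j = m.-1 -> 1 / 2 <= a /\ 1 / 2 <= m%:R + 1 - b &
    ar a b (k%:R + m%:R + e * ((f i)%:R + (f j)%:R + 2))].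
Proof.
move=> S e m4 le1 le2 le3.
have P := slices_profile S.
have [i [i2 ia Ai]] := slices_left_end S e m4 le1 le2.
have [j [j2 jb Aj]] := slices_left_end (slices_rev S) e m4 le1 le3.
have jm : (m.-1 <= m.+1 - j <= m)%N by clear -j2 m4; lia.
have j_2 : (m.+1 - j)%N = m.-1 -> j = 2%N by clear -j2 m4; lia.
have m3 : (3 + (m - 4) = m.-1)%N by clear -m4; lia.
have em : m.-1%:R = m%:R - 1 :> R by rewrite -subn1 natrB//; clear -m4; lia.
exists i, (m.+1 - j)%N; split => //.
  by move=> i_2 /j_2; split; [exact: ia|exact: jb].
have m4R : 4 <= m%:R :> R by rewrite (ler_nat R 4).
have M := profile_windows P 3 (m - 4).
rewrite m3 in M.
have e3 : 3%:R = 3 :> R by [].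
have := slices_a_lt1 S; have := slices_b_gtm S => bm a1.
have {}M := M ltac:(rewrite e3; lra) ltac:(rewrite em; lra).
rewrite e3 em in M.
rewrite (_ : 3 - 1 / 2 = 5 / 2) in M; last by field.
rewrite (_ : m%:R - 1 - 1 / 2 = m%:R - 3 / 2) in M; last by field.
rewrite (_ : m%:R + 1 - (m%:R + 1 - b) = b) in Aj; last by ring.
rewrite (_ : m%:R + 1 - 5 / 2 = m%:R - 3 / 2) in Aj; last by field.
rewrite (_ : m%:R + 1 - 1 = m%:R) in Aj; last by ring.
rewrite (_ : m%:R + 1 - 2 = m.-1%:R) in Aj; last by rewrite em; ring.
have B := profile_cat P a (5 / 2) (m%:R - 3 / 2) _ _ ltac:(lra) ltac:(lra) Ai M.
have := profile_cat P a (m%:R - 3 / 2) b _ _ ltac:(lra) ltac:(lra) B Aj.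
apply: (profile_mono P).
have := slices_sum_le S.
by rewrite sum_ends//; lra.
Qed.

End ManySlices.

(** * At least four slices, denominator at least three *)

Section AtLeastThree.
Context {R : realType}.
Implicit Types (a b t u v x y z e : R) (h : R -> R) (ar : R -> R -> R -> Prop)
  (m k l : nat) (f : nat -> nat).

Lemma slices_width_gt {l m k a b h ar f} : slices (l%:R : R) m k a b h ar f ->
  m%:R - 1 < b - a.
Proof. by move=> S; have := slices_a_lt1 S; have := slices_b_gtm S; lra. Qed.

(** The width exceeds m - 1, so at least m - 3 consecutive slices have a point and m - 5 have
    two. *)
Lemma slices_count_ge6 {l m k a b h ar f} : slices (l%:R : R) m k a b h ar f ->
  (6 <= m)%N -> forall i j, (0 < i <= 2)%N -> (m.-1 <= j <= m)%N ->
  (2 * m <= k + 8)%N /\ (f i + f j + m <= k + 5)%N.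
Proof.
move=> S m6 i j i2 jm.
have w := slices_width_gt S.
have e3 : (m - 3)%:R = m%:R - 3 :> R by rewrite natrB//; clear -m6; lia.
have e5 : (m - 5)%:R = m%:R - 5 :> R by rewrite natrB//; clear -m6; lia.
have [p [p0 pN _ p1]] := slices_level S 1 (m - 3) isT ltac:(rewrite e3; lra).
have [q [q0 qM _ q2]] := slices_level S 2 (m - 5) isT ltac:(rewrite e5; lra).
have sk := slices_sum S.
have A := windows_le_sum m f p _ q _ p0 pN q0 qM p1 q2.
have B := window_pair_le_sum m f p _ i j p0 pN ltac:(clear -i2 m6; lia)
  ltac:(clear -jm m6; lia) ltac:(clear -i2 jm m6; lia) p1.
by move: A B sk m6; clear; lia.
Qed.

Lemma sum3 f : (\sum_(1 <= j < 4) f j = f 1 + f 2 + f 3)%N.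
Proof. by do 2 (rewrite big_nat_recr//=); rewrite big_nat1. Qed.

Lemma sum4 f : (\sum_(1 <= j < 5) f j = f 1 + f 2 + f 3 + f 4)%N.
Proof. by rewrite big_nat_recr//= sum3. Qed.

Lemma sum5 f : (\sum_(1 <= j < 6) f j = f 1 + f 2 + f 3 + f 4 + f 5)%N.
Proof. by rewrite big_nat_recr//= sum4. Qed.

(** Two adjacent slices have points, while [i] and [j] are at least two apart; so some slice other
    than these two has a point. *)
Lemma slices_count_5 {l k a b h ar f} : slices (l%:R : R) 5 k a b h ar f ->
  forall i j, (0 < i <= 2)%N -> (4 <= j <= 5)%N -> (f i + f j < k)%N.
Proof.
move=> S i j i2 j5; have w := slices_width_gt S.
have [p [p0 pN _ p1]] := slices_level S 1 2 isT ltac:(lra).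
have := slices_sum S; rewrite sum5.
have p2 := p1 p.+1 ltac:(clear -p0; lia).
have {}p1 := p1 p ltac:(clear -p0; lia).
have : i = 1%N \/ i = 2%N by clear -i2; lia.
have : j = 4%N \/ j = 5%N by clear -j5; lia.
have : p = 1%N \/ p = 2%N \/ p = 3%N \/ p = 4%N by clear -p0 pN; lia.
clear -p1 p2 => H1 H2 H3 sk.
by case: H1 p1 p2 => [->|[->|[->|->]]]; case: H2 => ->; case: H3 => -> p1 p2; lia.
Qed.

(** Three consecutive slices have points, and one has two of them. Any three consecutive slices
    include at least two of the inner slices 2, 3, 4. *)
Lemma slices_count_5_wide {l k a b h ar f} : slices (l%:R : R) 5 k a b h ar f ->
  5 < b - a -> (3 < k)%N /\ (f 1 + f 5 + 2 <= k)%N.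
Proof.
move=> S w.
have [p [p0 pN _ p1]] := slices_level S 1 3 isT ltac:(lra).
have [q [q0 qN _ q1]] := slices_level S 2 1 isT ltac:(lra).
have := slices_sum S.
have := windows_le_sum 5 f p _ q _ p0 pN q0 qN p1 q1.
rewrite sum5.
have p2 := p1 p.+1 ltac:(clear -p0; lia).
have p3 := p1 p.+2 ltac:(clear -p0; lia).
have {}p1 := p1 p ltac:(clear -p0; lia).
have : p = 1%N \/ p = 2%N \/ p = 3%N by clear -p0 pN; lia.
clear -p1 p2 p3 => H1.
by case: H1 p1 p2 p3 => [->|[->|->]] p1 p2 p3 A B; lia.
Qed.

Lemma slices_count_4_wide {l k a b h ar f} : slices (l%:R : R) 4 k a b h ar f ->
  4 < b - a -> exists p, (0 < p < 4)%N /\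
   [/\ 1 < h p%:R, 1 < h p.+1%:R, (0 < f p)%N & (0 < f p.+1)%N].
Proof.
move=> S w.
have [p [p0 pN ph p1]] := slices_level S 1 2 isT ltac:(lra).
by exists p; split; [|split; (apply: ph || apply: p1)]; clear -p0 pN; lia.
Qed.

(** 5/8 is the value of the left side at a = 0. The alternative with 1/3 serves denominator 3, where
    1 - 2/l = 1/3. *)
Lemma end_slack a e : 0 <= a -> (a <= 1 / 2 -> 5 / 8 <= e \/ 1 / 3 <= a /\ 1 / 3 <= e) ->
  a <= 1 / 2 -> (1 / 2 - a) * (1 + (3 / 2 - a) / 2 / 3) <= e.
Proof.
move=> a0 H a2; have [e58|[a3 e3]] := H a2.
- have : 0 <= a * (2 - a) by rewrite mulr_ge0; lra.
  lra.
- have : 0 <= (a - 1 / 3) * (5 / 3 - a) by rewrite mulr_ge0; lra.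
  lra.
Qed.

(** The desired inequality is monotone in [e] and [r], so it suffices to check it at explicit
    constants. *)
Lemma count_arith (r r' K M s e e' : R) : 0 <= e <= e' -> 0 <= s -> r' <= r ->
  0 <= K -> K + M + e' * (s + 2) <= r' * (K + 1) ->
  K + M + e * (s + 2) <= r * (K + 1).
Proof.
move=> /andP[e0 ee] s0 rr K0 H.
have : 0 <= (e' - e) * (s + 2) by rewrite mulr_ge0; lra.
have : 0 <= (r - r') * (K + 1) by rewrite mulr_ge0; lra.
lra.
Qed.

Lemma count_arith6 (r K M s e : R) : 2 * M <= K + 8 -> s + M <= K + 5 ->
  4 <= K -> (8 / 3 <= r /\ e = 5 / 8) \/ (7 / 2 <= r /\ e = 1) ->
  K + M + e * (s + 2) <= r * (K + 1).
Proof.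
move=> MK sM K4 [[r3 ->]|[r3 ->]].
  have : 0 <= (r - 8 / 3) * (K + 1) by rewrite mulr_ge0; lra.
  lra.
have : 0 <= (r - 7 / 2) * (K + 1) by rewrite mulr_ge0; lra.
lra.
Qed.

Lemma slices_many_aux {l m k a b h ar f} : slices (l%:R : R) m k a b h ar f ->
  forall e, (4 <= m)%N -> 1 - 2 / l%:R <= e ->
  5 / 8 <= e \/ [/\ l = 3%N, 1 / 3 <= e & b - a <= m%:R] ->
  exists i j : nat, [/\ (0 < i <= 2)%N, (m.-1 <= j <= m)%N,
    i = 2%N -> j = m.-1 -> b - a <= m%:R &
    ar a b (k%:R + m%:R + e * ((f i)%:R + (f j)%:R + 2))].
Proof.
move=> S e m4 le1 H.
have a0 := slices_a0 S; have b1 := slices_b1 S.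
have a1 := slices_a1 S; have b0 := slices_b0 S.
have [||i [j [i2 jm ij A]]] := slices_total S e m4 le1.
- move=> a2; apply: end_slack => // _.
  (* For denominator 3 the right end piece b - m is at least 1/3, and b - a <= m passes this on to
     [a]; the other end is symmetric. *)
  case: H => [|[l3 e3 w]]; [by left|right; split => //].
  by rewrite l3 in b0; lra.
- move=> a2; apply: end_slack => //; first lra.
  move=> _; case: H => [|[l3 e3 w]]; [by left|right; split => //].
  by rewrite l3 in a1; lra.
- exists i, j; split => // i_2 j_2; have [] := ij i_2 j_2; lra.
Qed.

Lemma slices_many {l m k a b h ar f} : slices (l%:R : R) m k a b h ar f ->
  (3 <= l)%N -> (4 <= m)%N -> ar a b (ratio l%:R * (k%:R + 1)).
Proof.
move=> S l3 m4; have P := slices_profile S.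
have k2 := slices_k S.
have k2R : 2 <= k%:R :> R by rewrite (ler_nat R 2).
have L3 : 3 <= l%:R :> R by rewrite (ler_nat R 3).
have L0 : 0 < l%:R :> R by rewrite ltr0n; clear -l3; lia.
have li : 0 < (l%:R)^-1 :> R by rewrite invr_gt0.
(* The ratio is 8/3 and 25/8 at l = 3 and 4, where 5/8 exceeds 1 - 2/l. From l = 5 on it is at least
   7/2, which leaves room for the crude e = 1. *)
have rl : exists e : R, [/\ 1 - 2 / l%:R <= e, 5 / 8 <= e &
   [\/ l = 3%N /\ e = 5 / 8, e = 5 / 8 /\ 25 / 8 <= ratio (l%:R : R) |
       7 / 2 <= ratio (l%:R : R) /\ e = 1]].
  have [l5|l4] := leqP 5 l.
    exists 1; split; [lra|lra|apply: Or33; split => //].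
    have : 5 <= l%:R :> R by rewrite (ler_nat R 5).
    rewrite ratioE//; lra.
  have [->|->] : l = 3%N \/ l = 4%N by clear -l4 l3; lia.
    by exists (5 / 8); split; [lra|lra|apply: Or31].
  by exists (5 / 8); split; [lra|lra|apply: Or32; rewrite /ratio; split => //; lra].
have [e [le e58 Hr]] := rl.
have r83 : 8 / 3 <= ratio (l%:R : R).
  by case: Hr => [[-> _]|[_]|[]]; [rewrite /ratio; lra|lra|lra].
have [m6|m5] := leqP 6 m.
  have [i [j [i2 jm ij A]]] := slices_many_aux S e m4 le (or_introl e58).
  apply: (profile_mono P) A.
  have [mk fk] := slices_count_ge6 S m6 i j i2 jm.
  have k4 : (4 <= k)%N by clear -mk m6; lia.
  apply: count_arith6.
  - by rewrite -natrM -natrD ler_nat.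
  - by rewrite -!natrD ler_nat.
  - by rewrite (ler_nat R 4).
  - by case: Hr => [[l_3 e_]|[e_ r]|[r e_]]; [left|left|right]; split.
have k3R : k = 2%N \/ 3 <= k%:R :> R.
  by rewrite (ler_nat R 3); clear -k2; lia.
have e0 : 0 <= e by clear -e58; lra.
have third : 1 - 2 / 3%:R <= 1 / 3 :> R by lra.
have [m_5|m_4] : m = 5%N \/ m = 4%N by clear -m4 m5; lia.
- subst m.
  have sk1 i j : (0 < i <= 2)%N -> (4 <= j <= 5)%N ->
      (f i)%:R + (f j)%:R + 1 <= k%:R :> R.
    move=> i2 j5; have := slices_count_5 S i j i2 j5.
    by rewrite -(ler_nat R) -natr1 natrD.
  (* Here the bound is 8 and e = 5/8 overshoots it. A width above 5 would force four points, so the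
     width is at most m and e = 1/3 is available. *)
  have [[l_3 k_2]|lk] := EM (l = 3%N /\ k = 2%N).
    subst l k.
    have w : b - a <= 5.
      by rewrite leNgt; apply/negP => /(slices_count_5_wide S)[].
    have [i [j [i2 jm _ A]]] := slices_many_aux S (1 / 3) m4 third
      (or_intror (And3 erefl (lexx _) w)).
    apply: (profile_mono P) A.
    by have := sk1 i j i2 jm; rewrite /ratio; lra.
  have [i [j [i2 jm _ A]]] := slices_many_aux S e m4 le (or_introl e58).
  apply: (profile_mono P) A.
  have {i2 jm} := sk1 i j i2 jm.
  have : 0 <= (f i)%:R + (f j)%:R :> R by rewrite addr_ge0.
  move: (_ + _ :> R) => s s0 sk1'.
  case: Hr => [[l_3 e_]|[e_ r]|[r e_]].
  - case: k3R => [k_2|k3]; first by case: lk.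
    by apply: (count_arith _ (8 / 3) _ _ _ _ (5 / 8)); lra.
  - by apply: (count_arith _ (25 / 8) _ _ _ _ (5 / 8)); lra.
  - by apply: (count_arith _ (7 / 2) _ _ _ _ 1); lra.
- subst m.
  have sk4 := slices_sum S; rewrite sum4 in sk4.
  have ik i : (0 < i <= 2)%N -> i = 1%N \/ i = 2%N by clear; lia.
  have jk j : (4.-1 <= j <= 4)%N -> j = 3%N \/ j = 4%N by clear; lia.
  have [[l_3 k_2]|lk] := EM (l = 3%N /\ k = 2%N).
    subst l k.
    have [w|w] := leP (b - a) 4.
      have [i [j [/ik i2 /jk jm _ A]]] := slices_many_aux S (1 / 3) m4 third
        (or_intror (And3 erefl (lexx _) w)).
      apply: (profile_mono P) A.
      have : (f i + f j <= 2)%N by case: i2 => ->; case: jm => ->; clear -sk4; lia.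
      by rewrite -(ler_nat R) natrD /ratio; lra.
    have [i [j [/ik i2 /jk jm ij A]]] := slices_many_aux S e m4 le (or_introl e58).
    apply: (profile_mono P) A.
    (* The two points lie on adjacent slices, one on each. Both could be charged only for i = 2 and
       j = 3, but then both ends would be short and the width at most 4. *)
    have [p [p3 [_ _ p1 p2]]] := slices_count_4_wide S w.
    have : (f i + f j <= 1)%N.
      have i23 : ~ (i = 2%N /\ j = 3%N) by move=> [i_2 j_3]; have := ij i_2 j_3; lra.
      have : p = 1%N \/ p = 2%N \/ p = 3%N by clear -p3; lia.
      move: p1 p2 sk4 i2 jm i23; clear => p1 p2 sk4 i2 jm i23 pp.
      case: pp p1 p2 => [->|[->|->]] p1 p2;
        case: i2 i23 => ->; case: jm => -> i23; lia.
    rewrite -(ler_nat R) natrD.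
    case: Hr => [[_ ->]|[_]|[]]; rewrite /ratio; lra.
  have [i [j [/ik i2 /jk jm _ A]]] := slices_many_aux S e m4 le (or_introl e58).
  apply: (profile_mono P) A.
  have : (f i + f j <= k)%N by case: i2 => ->; case: jm => ->; clear -sk4; lia.
  rewrite -(ler_nat R) natrD.
  have : 0 <= (f i)%:R + (f j)%:R :> R by rewrite addr_ge0.
  move: (_ + _ :> R) => s s0 sk1'.
  case: Hr => [[l_3 e_]|[e_ r]|[r e_]].
  - case: k3R => [k_2|k3]; first by case: lk.
    by apply: (count_arith _ (8 / 3) _ _ _ _ (5 / 8)); lra.
  - by apply: (count_arith _ (25 / 8) _ _ _ _ (5 / 8)); lra.
  - by apply: (count_arith _ (7 / 2) _ _ _ _ 1); lra.
Qed.

End AtLeastThree.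

(** * Exactly three slices, denominator at least three *)

Section ThreeSlices.
Context {R : realType}.
Implicit Types (a b t u v x y z e : R) (h : R -> R) (ar : R -> R -> R -> Prop)
  (m k l : nat) (f : nat -> nat).

(** 11/16 is the value at a = 0; the last divisor 2 is the lower bound for b - 1 when m = 3. *)
Lemma full_end_slack a : 0 <= a -> a <= 1 / 2 ->
  (1 / 2 - a) * (1 + (3 / 2 - a) / 2 / 2) <= 11 / 16.
Proof.
move=> a0 a2; have : 0 <= a * (3 - a) by rewrite mulr_ge0; lra.
lra.
Qed.

(** Both ends are short and the left one is the shorter, so the gap [2 - a, 6 - b] between the
    windows at 1 and 3 fits into the window [2 - a, 2 + a] of slice 2. *)
Lemma slices_three_levers {l k a b h ar f} : slices (l%:R : R) 3 k a b h ar f ->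
  (3 <= l)%N -> 1 / 2 <= a -> b <= 7 / 2 -> 4 - a <= b ->
  ar a b (ratio l%:R * (k%:R + 1)).
Proof.
move=> S l3 a2 b2 ab; have P := slices_profile S.
have a1 := slices_a_lt1 S; have b3 := slices_b_gtm S.
have W1 := profile_window P 1 (1 - a) ltac:(lra) ltac:(lra) ltac:(lra).
have W2 := profile_half_window P 2 (2 - a) (6 - b)
  ltac:(lra) ltac:(lra) ltac:(lra) ltac:(lra) ltac:(lra).
have W3 := profile_window P 3 (b - 3) ltac:(lra) ltac:(lra) ltac:(lra).
rewrite (_ : 1 - (1 - a) = a) in W1; last by ring.
rewrite (_ : 1 + (1 - a) = 2 - a) in W1; last by ring.
rewrite (_ : 2 - (2 - a) = a) in W2; last by ring.
rewrite (_ : 3 - (b - 3) = 6 - b) in W3; last by ring.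
rewrite (_ : 3 + (b - 3) = b) in W3; last by ring.
have W := profile_cat P a (2 - a) (6 - b) _ _ ltac:(lra) ltac:(lra) W1 W2.
apply: (profile_mono P)
  (profile_cat P a (6 - b) b _ _ ltac:(lra) ltac:(lra) W W3).
have f1 := slices_le S 1 isT.
have f2 := slices_le S 2 isT.
have f3 := slices_le S 3 isT.
have := slices_sum S; rewrite sum3 -(ler_nat R) !natrD => fk.
have la := slices_a1 S.
have k2R := slices_k S; rewrite -(ler_nat R) in k2R.
have f10 : 0 <= (f 1)%:R :> R by []. have f30 : 0 <= (f 3)%:R :> R by [].
clear S P W1 W2 W3 W.
(* The weights 2 (1 - a) and 2 (b - 3) of the outer slices are at most 1, hence at most the weight 2
   a of slice 2; the three weights sum to at most 3. *)
apply: (@le_trans _ _ (2 * a * k%:R + 3)).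
  have : 0 <= (1 - a) * ((f 1)%:R + 1 - h 1) by rewrite mulr_ge0; lra.
  have : 0 <= a * ((f 2)%:R + 1 - h 2) by rewrite mulr_ge0; lra.
  have : 0 <= (b - 3) * ((f 3)%:R + 1 - h 3) by rewrite mulr_ge0; lra.
  have : 0 <= (2 * a - 1) * (f 1)%:R by rewrite mulr_ge0; lra.
  have : 0 <= (a - (b - 3)) * (f 3)%:R by rewrite mulr_ge0; lra.
  have : 0 <= a * (k%:R - (f 1)%:R - (f 2)%:R - (f 3)%:R) by rewrite mulr_ge0; lra.
  by move: b2; clear; lra.
have [l_3|l4] : l = 3%N \/ (4 <= l)%N by clear -l3; lia.
  rewrite l_3 in la *; rewrite /ratio.
  have : 0 <= (2 / 3 - a) * k%:R by rewrite mulr_ge0; lra.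
  by move: k2R; clear; lra.
have r3 : 3 <= ratio (l%:R : R).
  have : 4 <= l%:R :> R by rewrite (ler_nat R 4).
  move=> l4R; rewrite ratioE; last lra.
  have : 0 <= (l%:R : R)^-1 by rewrite invr_ge0.
  by lra.
have : 0 <= (1 - a) * k%:R by rewrite mulr_ge0; lra.
have : 0 <= (ratio (l%:R : R) - 3) * (k%:R + 1) by rewrite mulr_ge0; lra.
by move: k2R; clear; lra.
Qed.

(** The full right end is charged to slice 3, the left end to slice 2 or 1 according to its length;
    being distinct, the two charged slices carry at most [k] points together. *)
Lemma slices_three_full {l k a b h ar f} : slices (l%:R : R) 3 k a b h ar f ->
  (3 <= l)%N -> 7 / 2 <= b -> ar a b (ratio l%:R * (k%:R + 1)).
Proof.
move=> S l3 b2; have P := slices_profile S.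
have a1 := slices_a_lt1 S; have b4 := slices_b1 S.
have a0 := slices_a0 S.
have h1 := slices_ge0 S 1 isT; have h2 := slices_ge0 S 2 isT.
have h3 := slices_ge0 S 3 isT.
have f1 := slices_le S 1 isT.
have f2 := slices_le S 2 isT.
have f3 := slices_le S 3 isT.
have := slices_sum S; rewrite sum3 -(ler_nat R) !natrD => fk.
have k2R := slices_k S; rewrite -(ler_nat R) in k2R.
have f10 : 0 <= (f 1)%:R :> R by []. have f30 : 0 <= (f 3)%:R :> R by [].
have f20 : 0 <= (f 2)%:R :> R by [].
have la := slices_a1 S.
have B := profile_full_end (profile_rev 4 _ _ _ _ P) 2 (11 / 16) ltac:(clear -b4; lra)
  ltac:(clear -b2; lra) ltac:(clear -a1; lra) ltac:(clear; lra) ltac:(clear -a1; lra)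
  (full_end_slack (4 - b) ltac:(clear -b4; lra) ltac:(clear -b2; lra)).
rewrite (_ : 4 - (4 - b) = b) in B; last by ring.
rewrite (_ : 4 - 3 / 2 = 5 / 2) in B; last by field.
rewrite (_ : 4 - 1 = 3) in B; last by ring.
have [e [e1 e2 er]] : exists e : R, [/\ 1 - 2 / l%:R <= e, 11 / 16 <= e &
   e = 11 / 16 /\ 8 / 3 <= ratio (l%:R : R) \/ e = 1 /\ 7 / 2 <= ratio (l%:R : R)].
  have l0 : 0 < l%:R :> R by rewrite ltr0n; clear -l3; lia.
  have li : 0 < (l%:R)^-1 :> R by rewrite invr_gt0.
  have [l5|l4] := leqP 5 l.
    exists 1; split; [lra|lra|right; split => //].
    have : 5 <= l%:R :> R by rewrite (ler_nat R 5).
    by rewrite ratioE//; lra.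
  exists (11 / 16).
  have [->|->] : l = 3%N \/ l = 4%N by clear -l4 l3; lia.
    by split; [lra|lra|left; rewrite /ratio; split => //; lra].
  by split; [lra|lra|left; rewrite /ratio; split => //; lra].
have [i [j [ij A]]] : exists i j : nat,
    ((f i)%:R + (f j)%:R <= k%:R :> R) /\
    ar a b (k%:R + 3 + e * ((f i)%:R + (f j)%:R + 2)).
  have [a2|a2] := leP (1 / 2) a.
    exists 2, 3; split; first by clear -fk f10; lra.
    have A := profile_lever_two P l%:R (slices_l S) la a2
      ltac:(clear -b2; lra).
    apply: (profile_mono P) (profile_cat P a (5 / 2) b _ _
      ltac:(clear -a1; lra) ltac:(clear -b2; lra) A B).
    have : 0 <= (e - (1 - 2 / l%:R)) * h 2 by rewrite mulr_ge0// subr_ge0.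
    have : 0 <= (e - 11 / 16) * h 3 by rewrite mulr_ge0// subr_ge0.
    have : 0 <= e * ((f 2)%:R + 1 - h 2) by clear -e2 f2; rewrite mulr_ge0; lra.
    have : 0 <= e * ((f 3)%:R + 1 - h 3) by clear -e2 f3; rewrite mulr_ge0; lra.
    by move: fk f1 f2 f3; clear; lra.
  exists 1, 3; split; first by clear -fk f20; lra.
  have A := profile_full_end P 2 (11 / 16) a0 (ltW a2) ltac:(clear -b2; lra)
    ltac:(clear; lra) ltac:(clear -b2; lra) (full_end_slack _ a0 (ltW a2)).
  have W := profile_window P 2 (1 / 2) ltac:(clear; lra) ltac:(clear -a2; lra) ltac:(clear -b2; lra).
  rewrite (_ : 2 - 1 / 2 = 3 / 2) in W; last by field.
  rewrite (_ : 2 + 1 / 2 = 5 / 2) in W; last by field.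
  have C := profile_cat P a (3 / 2) (5 / 2) _ _
    ltac:(clear -a2; lra) ltac:(clear; lra) A W.
  apply: (profile_mono P) (profile_cat P a (5 / 2) b _ _
    ltac:(clear -a1; lra) ltac:(clear -b2; lra) C B).
  have : 0 <= (e - 11 / 16) * h 1 by rewrite mulr_ge0// subr_ge0.
  have : 0 <= (e - 11 / 16) * h 3 by rewrite mulr_ge0// subr_ge0.
  have : 0 <= e * ((f 1)%:R + 1 - h 1) by clear -e2 f1; rewrite mulr_ge0; lra.
  have : 0 <= e * ((f 3)%:R + 1 - h 3) by clear -e2 f3; rewrite mulr_ge0; lra.
  by move: fk f1 f2 f3; clear; lra.
apply: (profile_mono P) A.
have : 0 <= (f i)%:R + (f j)%:R :> R by rewrite addr_ge0.
move: (_ + _ :> R) ij => s sk s0; clear -sk s0 er k2R.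
case: er => [[-> r]|[-> r]].
  by apply: (count_arith _ (8 / 3) _ _ _ _ (11 / 16)); lra.
by apply: (count_arith _ (7 / 2) _ _ _ _ 1); lra.
Qed.

Lemma slices_three {l k a b h ar f} : slices (l%:R : R) 3 k a b h ar f ->
  (3 <= l)%N -> ar a b (ratio l%:R * (k%:R + 1)).
Proof.
move=> S l3; have S' := slices_rev S.
have e1 : 3%:R + 1 - (3%:R + 1 - a) = a by ring.
have e2 : 3%:R + 1 - (3%:R + 1 - b) = b by ring.
have [b2|b2] := leP (7 / 2) b; first exact: slices_three_full S l3 b2.
have [a2|a2] := leP a (1 / 2).
  have := slices_three_full S' l3; rewrite e1 e2; apply; lra.
have [ab|ab] := leP (4 - a) b.
  exact: slices_three_levers S l3 (ltW a2) (ltW b2) ab.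
have := slices_three_levers S' l3; rewrite e1 e2; apply; lra.
Qed.

End ThreeSlices.

(** * Denominator two, at least three slices *)

Section HalfIntegral.
Context {R : realType}.
Implicit Types (a b t u v x y z e : R) (h : R -> R) (ar : R -> R -> R -> Prop)
  (m k l : nat) (f : nat -> nat).

Lemma sum_ends1 (F : nat -> R) m : (3 <= m)%N ->
  \sum_(1 <= j < m.+1) F j = F 1 + \sum_(2 <= j < m) F j + F m.
Proof.
case: m => [|[|[|m]]]// _; rewrite big_ltn// big_nat_recr//=.
by rewrite !addrA.
Qed.

Lemma profile_parts {a b h ar} m x y : profile a b h ar -> (3 <= m)%N ->
  a <= 1 / 2 -> m%:R + 1 / 2 <= b -> ar a (3 / 2) (h 1 + x) ->
  ar (m%:R - 1 / 2) b (h m%:R + y) ->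
  ar a b (\sum_(1 <= j < m.+1) h j%:R + x + y).
Proof.
move=> P m3 a2 b2 A B.
have m3R : 3 <= m%:R :> R by rewrite (ler_nat R 3).
have em : (2 + (m - 2))%N = m by clear -m3; lia.
have M := profile_windows P 2 (m - 2) ltac:(clear -a2; lra)
  ltac:(rewrite em; clear -b2; lra).
rewrite em (_ : 2 - 1 / 2 = 3 / 2 :> R) in M; last by field.
have C := profile_cat P a (3 / 2) (m%:R - 1 / 2) _ _
  ltac:(clear -a2; lra) ltac:(clear -m3R; lra) A M.
have := profile_cat P a (m%:R - 1 / 2) b _ _
  ltac:(clear -a2 m3R; lra) ltac:(clear -b2; lra) C B.
by apply: (profile_mono P); rewrite sum_ends1//; lra.
Qed.

(** An end piece of length 1/2 is exactly half of the unit window at 1, so it has no excess. *)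
Lemma profile_half_end {a b h ar} : profile a b h ar -> a = 1 / 2 -> 3 <= b ->
  ar a (3 / 2) (h 1 + 0).
Proof.
move=> P a2 b3; rewrite addr0.
have := profile_window P 1 (1 / 2) ltac:(lra) ltac:(lra) ltac:(lra).
rewrite (_ : 1 - 1 / 2 = a) ?a2; last by field.
rewrite (_ : 1 + 1 / 2 = 3 / 2); last by field.
by rewrite (_ : 2 * (1 / 2) * h 1 = h 1)//; field.
Qed.

Lemma profile_unit_end {a b h ar} : profile a b h ar -> a = 0 -> 3 <= b ->
  ar a (3 / 2) (h 1 + (h 1 / 2 + 3 / 8 * (h 1 - h 2))).
Proof.
move=> P a0 b3.
have := profile_end_full P ltac:(lra) ltac:(lra) ltac:(lra).
by apply: (profile_mono P); rewrite a0; lra.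
Qed.

(** A width above m, instead of m - 1, gains one slice at each level. *)
Lemma slices_count_wide {m k a b h ar f} : slices (2 : R) m k a b h ar f ->
  (5 <= m)%N -> m%:R < b - a ->
  [/\ (2 * m <= k + 6)%N, (f 1 + f m + m <= k + 4)%N & (f 1 + m <= k + 3)%N].
Proof.
move=> S m5 w.
have e2 : (m - 2)%:R = m%:R - 2 :> R by rewrite natrB//; clear -m5; lia.
have e4 : (m - 4)%:R = m%:R - 4 :> R by rewrite natrB//; clear -m5; lia.
have [p [p0 pN _ p1]] := slices_level S 1 (m - 2) isT ltac:(rewrite e2; lra).
have [q [q0 qM _ q2]] := slices_level S 2 (m - 4) isT ltac:(rewrite e4; lra).
have sk := slices_sum S.
have A := windows_le_sum m f p _ q _ p0 pN q0 qM p1 q2.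
have B := window_pair_le_sum m f p _ 1 m p0 pN ltac:(clear -m5; lia)
  ltac:(clear -m5; lia) ltac:(clear -m5; lia) p1.
have C := window_one_le_sum m f p _ 1 p0 pN ltac:(clear -m5; lia) p1.
by move: A B C sk m5; clear => A B C sk m5; split; lia.
Qed.

Lemma natr0_or1 (n : nat) : n%:R = 0 :> R \/ 1 <= n%:R :> R.
Proof. by case: n => [|n]; [left|right; rewrite ler1n]. Qed.

Lemma slices_half_half {m k a b h ar f} : slices (2 : R) m k a b h ar f ->
  (3 <= m)%N -> a = 1 / 2 -> b = m%:R + 1 / 2 ->
  ar a b (9 / 4 * (k%:R + 1)).
Proof.
move=> S m3 a2 b2; have P := slices_profile S.
have m3R : 3 <= m%:R :> R by rewrite (ler_nat R 3).
have b3 : 3 <= b by lra.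
have A := profile_half_end P a2 b3.
have := profile_half_end (profile_rev (m%:R + 1) _ _ _ _ P)
  ltac:(lra) ltac:(lra).
rewrite (_ : m%:R + 1 - (m%:R + 1 - b) = b); last by ring.
rewrite (_ : m%:R + 1 - 3 / 2 = m%:R - 1 / 2); last by field.
rewrite (_ : m%:R + 1 - 1 = m%:R); last by ring.
move=> B; apply: (profile_mono P)
  (profile_parts m _ _ P m3 ltac:(lra) ltac:(lra) A B).
have sk := slices_sum_le S.
have k2 := slices_k S.
have k2R : 2 <= k%:R :> R by rewrite (ler_nat R 2).
have [m6|m5] := leqP 6 m.
  have [k6 _] := slices_count_ge6 S m6 1 m isT ltac:(clear -m3; lia).
  have : 2 * m%:R <= k%:R + 8 :> R by rewrite -natrM -natrD ler_nat.
  have : 6 <= m%:R :> R by rewrite (ler_nat R 6).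
  by move: sk; clear; lra.
have [m4|m_5] : (m <= 4)%N \/ m = 5%N by clear -m5; lia.
  have : m%:R <= 4 :> R by rewrite (ler_nat R _ 4).
  by move: sk k2R; clear; lra.
subst m.
(* For k = 2 the estimate k + m = 7 exceeds the bound 27/4. Two adjacent slices then carry one point
   each, and concavity prevents all slices from attaining [f j + 1] at once. *)
have [k_2|k3] : k = 2%N \/ 3 <= k%:R :> R by rewrite (ler_nat R 3); clear -k2; lia.
  subst k.
  have [p [p0 pN ph p1]] := slices_level S 1 2 isT ltac:(lra).
  have hp2 := ph p.+1 ltac:(clear -p0; lia).
  have {}ph := ph p ltac:(clear -p0; lia).
  have c1 := slices_concave S 1 isT isT.
  have c2 := slices_concave S 2 isT isT.
  have c3 := slices_concave S 3 isT isT.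
  have p2 := p1 p.+1 ltac:(clear -p0; lia).
  have {}p1 := p1 p ltac:(clear -p0; lia).
  have := slices_sum S; rewrite sum5 => fs.
  have f1 := slices_le S 1 isT.
  have f2 := slices_le S 2 isT.
  have f3 := slices_le S 3 isT.
  have f4 := slices_le S 4 isT.
  have f5 := slices_le S 5 isT.
  have : p = 1%N \/ p = 2%N \/ p = 3%N \/ p = 4%N by clear -p0 pN; lia.
  do 4 (rewrite big_nat_recr//=); rewrite big_nat1.
  clear S P A B sk a2 b2 b3 m3 m5 m3R k2 k2R p0 pN.
  move=> [pE|[pE|[pE|pE]]]; subst p.
  - have e3 : f 3%N = 0%N by clear -fs p1 p2; lia.
    have e4 : f 4%N = 0%N by clear -fs p1 p2; lia.
    have e5 : f 5%N = 0%N by clear -fs p1 p2; lia.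
    have e1 : f 1%N = 1%N by clear -fs p1 p2; lia.
    rewrite e1 e3 e4 e5 in f1 f3 f4 f5; clear -f1 f2 f3 f4 f5 ph hp2 c1 c2 c3.
    lra.
  - have e1 : f 1%N = 0%N by clear -fs p1 p2; lia.
    have e4 : f 4%N = 0%N by clear -fs p1 p2; lia.
    have e5 : f 5%N = 0%N by clear -fs p1 p2; lia.
    have e2 : f 2%N = 1%N by clear -fs p1 p2; lia.
    rewrite e1 e2 e4 e5 in f1 f2 f4 f5; clear -f1 f2 f3 f4 f5 ph hp2 c1 c2 c3.
    lra.
  - have e1 : f 1%N = 0%N by clear -fs p1 p2; lia.
    have e2 : f 2%N = 0%N by clear -fs p1 p2; lia.
    have e5 : f 5%N = 0%N by clear -fs p1 p2; lia.
    have e4 : f 4%N = 1%N by clear -fs p1 p2; lia.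
    rewrite e1 e2 e4 e5 in f1 f2 f4 f5; clear -f1 f2 f3 f4 f5 ph hp2 c1 c2 c3.
    lra.
  - have e1 : f 1%N = 0%N by clear -fs p1 p2; lia.
    have e2 : f 2%N = 0%N by clear -fs p1 p2; lia.
    have e3 : f 3%N = 0%N by clear -fs p1 p2; lia.
    have e5 : f 5%N = 1%N by clear -fs p1 p2; lia.
    rewrite e1 e2 e3 e5 in f1 f2 f3 f5; clear -f1 f2 f3 f4 f5 ph hp2 c1 c2 c3.
    lra.
by move: sk k3; clear; lra.
Qed.

Lemma slices_unit_unit {m k a b h ar f} : slices (2 : R) m k a b h ar f ->
  (3 <= m)%N -> a = 0 -> b = m%:R + 1 -> ar a b (9 / 4 * (k%:R + 1)).
Proof.
move=> S m3 a2 b2; have P := slices_profile S.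
have m3R : 3 <= m%:R :> R by rewrite (ler_nat R 3).
have b3 : 3 <= b by lra.
have A := profile_unit_end P a2 b3.
have := profile_unit_end (profile_rev (m%:R + 1) _ _ _ _ P)
  ltac:(lra) ltac:(lra).
rewrite (_ : m%:R + 1 - (m%:R + 1 - b) = b); last by ring.
rewrite (_ : m%:R + 1 - 3 / 2 = m%:R - 1 / 2); last by field.
rewrite (_ : m%:R + 1 - 1 = m%:R); last by ring.
rewrite (_ : m%:R + 1 - 2 = m%:R - 1); last by ring.
move=> B; apply: (profile_mono P)
  (profile_parts m _ _ P m3 ltac:(lra) ltac:(lra) A B).
have sk := slices_sum_le S.
have k2 := slices_k S.
have k2R : 2 <= k%:R :> R by rewrite (ler_nat R 2).
have f1 := slices_le S 1 ltac:(clear -m3; lia).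
have fm := slices_le S m ltac:(clear -m3; lia).
(* By concavity the first increment of [h] is at least the last, so the extrapolation terms of the
   two ends add up to at most 0. *)
have ends : h 1 - h 2 + (h m%:R - h (m%:R - 1)) <= 0.
  have c1 := profile_concave P 1 2 m%:R
    ltac:(lra) ltac:(lra) ltac:(lra) ltac:(lra).
  have c2 := profile_concave P 1 (m%:R - 1) m%:R
    ltac:(lra) ltac:(lra) ltac:(lra) ltac:(lra).
  rewrite -(pmulr_rle0 _ (_ : 0 < m%:R - 1)); last lra.
  by move: c1 c2; clear; lra.
have [m5|m4] := leqP 5 m.
  have w : m%:R < b - a by lra.
  have [mk fk _] := slices_count_wide S m5 w.
  have mk' : 2 * m%:R <= k%:R + 6 :> R by rewrite -natrM -natrD ler_nat.
  have fk' : (f 1)%:R + (f m)%:R + m%:R <= k%:R + 4 :> R by rewrite -!natrD ler_nat.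
  have [m6|m_5] : 6 <= m%:R :> R \/ m = 5%N by rewrite (ler_nat R 6); clear -m5; lia.
    by move: ends sk f1 fm mk' fk' m6; clear; lra.
  subst m; have [k4 {}fk] := slices_count_5_wide S w.
  have {}k4 : 4 <= k%:R :> R by rewrite (ler_nat R 4).
  have {}fk : (f 1)%:R + (f 5)%:R + 2 <= k%:R :> R by rewrite -!natrD ler_nat.
  by move: ends sk f1 fm k4 fk; clear; lra.
have f10 : 0 <= (f 1)%:R :> R by []. have fm0 : 0 <= (f m)%:R :> R by [].
have [m_3|m_4] : m = 3%N \/ m = 4%N by clear -m3 m4; lia.
- subst m; have := slices_sum S.
  rewrite sum3 -(ler_nat R) !natrD => fs.
  have f20 : 0 <= (f 2)%:R :> R by [].
  have [k_2|k3] : k = 2%N \/ 3 <= k%:R :> R by rewrite (ler_nat R 3); clear -k2; lia.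
    subst k; have f2 := slices_le S 2 isT.
    do 2 (rewrite big_nat_recr//=); rewrite big_nat1 in ends *.
    rewrite (_ : 3 - 1 = 2) in ends *; last by ring.
    have [f2_0|f2_1] := natr0_or1 (f 2).
      by move: ends f1 f2 fm fs f10 fm0 f2_0; clear; lra.
    by move: ends f1 f2 fm fs f10 fm0 f2_1; clear; lra.
  by move: ends sk f1 fm fs f20 k3; clear; lra.
subst m; have w : 4 < b - a by lra.
have [p [p3 [h1 h2 p1 p2]]] := slices_count_4_wide S w.
have := slices_sum S; rewrite sum4 => fs.
have pp : p = 1%N \/ p = 2%N \/ p = 3%N by clear -p3; lia.
have [k_2|k3] : k = 2%N \/ 3 <= k%:R :> R by rewrite (ler_nat R 3); clear -k2; lia.
  subst k.
  have g2 := slices_le S 2 isT.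
  have g3 := slices_le S 3 isT.
  have c1 := slices_concave S 1 isT isT.
  have c2 := slices_concave S 2 isT isT.
  do 3 (rewrite big_nat_recr//=); rewrite big_nat1.
  rewrite (_ : 4 - 1 = 3); last by ring.
  clear S P A B sk a2 b2 b3 m3 m4 m3R k2 k2R f10 fm0 w ends.
  move: pp => [pE|[pE|pE]]; subst p.
  - have e3 : f 3%N = 0%N by clear -fs p1 p2; lia.
    have e4 : f 4%N = 0%N by clear -fs p1 p2; lia.
    have e1 : f 1%N = 1%N by clear -fs p1 p2; lia.
    rewrite e1 e3 e4 in f1 g3 fm; clear -f1 g2 g3 fm h1 h2 c1 c2.
    lra.
  - have e1 : f 1%N = 0%N by clear -fs p1 p2; lia.
    have e4 : f 4%N = 0%N by clear -fs p1 p2; lia.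
    have e2 : f 2%N = 1%N by clear -fs p1 p2; lia.
    have e3 : f 3%N = 1%N by clear -fs p1 p2; lia.
    rewrite e1 e2 e3 e4 in f1 g2 g3 fm; clear -f1 g2 g3 fm h1 h2 c1 c2.
    lra.
  - have e1 : f 1%N = 0%N by clear -fs p1 p2; lia.
    have e2 : f 2%N = 0%N by clear -fs p1 p2; lia.
    have e4 : f 4%N = 1%N by clear -fs p1 p2; lia.
    rewrite e1 e2 e4 in f1 g2 fm; clear -f1 g2 g3 fm h1 h2 c1 c2.
    lra.
have {}fs : (f 1 + f 4 + 1 <= k)%N.
  by case: pp p1 p2 => [->|[->|->]] p1 p2; clear -fs p1 p2; lia.
have {}fs : (f 1)%:R + (f 4)%:R + 1 <= k%:R :> R.
  by rewrite -natrD natr1 ler_nat -addn1.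
by move: ends sk f1 fm fs k3; clear; lra.
Qed.

Lemma slices_unit_half {m k a b h ar f} : slices (2 : R) m k a b h ar f ->
  (3 <= m)%N -> a = 0 -> b = m%:R + 1 / 2 -> ar a b (9 / 4 * (k%:R + 1)).
Proof.
move=> S m3 a2 b2; have P := slices_profile S.
have m3R : 3 <= m%:R :> R by rewrite (ler_nat R 3).
have b3 : 3 <= b by lra.
have A := profile_unit_end P a2 b3.
have := profile_half_end (profile_rev (m%:R + 1) _ _ _ _ P)
  ltac:(lra) ltac:(lra).
rewrite (_ : m%:R + 1 - (m%:R + 1 - b) = b); last by ring.
rewrite (_ : m%:R + 1 - 3 / 2 = m%:R - 1 / 2); last by field.
rewrite (_ : m%:R + 1 - 1 = m%:R); last by ring.
move=> B; apply: (profile_mono P)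
  (profile_parts m _ _ P m3 ltac:(lra) ltac:(lra) A B).
have sk := slices_sum_le S.
have k2 := slices_k S.
have k2R : 2 <= k%:R :> R by rewrite (ler_nat R 2).
have h1 := slices_ge0 S 1 ltac:(clear -m3; lia).
have f1 := slices_le S 1 ltac:(clear -m3; lia).
have hb := profile_ge0 P b ltac:(lra).
(* A descent already present between 1 and 2 continues up to b, where [h] is still nonnegative, and
   b - 1 = m - 1/2. *)
have slope : (h 1 - h 2) * (m%:R - 1 / 2) <= h 1.
  have := profile_concave P 1 2 b ltac:(lra) ltac:(lra) ltac:(lra) ltac:(lra).
  by rewrite b2; move: hb; rewrite b2; clear; lra.
have [m5|m4] := leqP 5 m.
  have w : m%:R < b - a by lra.
  have [mk _ fk] := slices_count_wide S m5 w.
  have mk' : 2 * m%:R <= k%:R + 6 :> R by rewrite -natrM -natrD ler_nat.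
  have fk' : (f 1)%:R + m%:R <= k%:R + 3 :> R by rewrite -!natrD ler_nat.
  have {}slope : (h 1 - h 2) * 3 <= h 1.
    have [h12|h12] := leP (h 1) (h 2); first by clear -h12 h1; lra.
    have m5R : 5 <= m%:R :> R by rewrite (ler_nat R 5).
    by apply: le_trans slope; rewrite ler_wpM2l; [|clear -h12; lra|clear -m5R; lra].
  have : 5 <= m%:R :> R by rewrite (ler_nat R 5).
  by move: slope sk f1 mk' fk'; clear; lra.
have f10 : 0 <= (f 1)%:R :> R by [].
have [m_3|m_4] : m = 3%N \/ m = 4%N by clear -m3 m4; lia.
- subst m; have := slices_sum S.
  rewrite sum3 -(ler_nat R) !natrD => fs.
  have f20 : 0 <= (f 2)%:R :> R by []. have f30 : 0 <= (f 3)%:R :> R by [].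
  have [k_2|k3] : k = 2%N \/ 3 <= k%:R :> R by rewrite (ler_nat R 3); clear -k2; lia.
    subst k; have f2 := slices_le S 2 isT.
    have f3 := slices_le S 3 isT.
    have c1 := slices_concave S 1 isT isT.
    have h3 := slices_ge0 S 3 isT.
    do 2 (rewrite big_nat_recr//=); rewrite big_nat1.
    have [f2_0|f2_1] := natr0_or1 (f 2).
      by move: c1 f1 f2 f3 fs f10 f30 f2_0 h1 h3; clear; lra.
    by move: c1 f1 f2 f3 fs f10 f30 f2_1 h1 h3; clear; lra.
  by move: slope sk f1 fs f20 f30 k3; clear; lra.
subst m; have w : 4 < b - a by lra.
have [p [p3 [g1 g2 p1 p2]]] := slices_count_4_wide S w.
have := slices_sum S; rewrite sum4 => fs.
have pp : p = 1%N \/ p = 2%N \/ p = 3%N by clear -p3; lia.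
have [k_2|k3] : k = 2%N \/ 3 <= k%:R :> R by rewrite (ler_nat R 3); clear -k2; lia.
  subst k.
  have f2 := slices_le S 2 isT.
  have f3 := slices_le S 3 isT.
  have f4 := slices_le S 4 isT.
  have c1 := slices_concave S 1 isT isT.
  have c2 := slices_concave S 2 isT isT.
  do 3 (rewrite big_nat_recr//=); rewrite big_nat1.
  clear S P A B sk a2 b2 b3 m3 m4 m3R k2 k2R f10 w slope.
  move: pp => [pE|[pE|pE]]; subst p.
  - have e3 : f 3%N = 0%N by clear -fs p1 p2; lia.
    have e4 : f 4%N = 0%N by clear -fs p1 p2; lia.
    have e1 : f 1%N = 1%N by clear -fs p1 p2; lia.
    rewrite e1 e3 e4 in f1 f3 f4; clear -f1 f2 f3 f4 g1 g2 c1 c2.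
    lra.
  - have e1 : f 1%N = 0%N by clear -fs p1 p2; lia.
    have e4 : f 4%N = 0%N by clear -fs p1 p2; lia.
    have e2 : f 2%N = 1%N by clear -fs p1 p2; lia.
    have e3 : f 3%N = 1%N by clear -fs p1 p2; lia.
    rewrite e1 e2 e3 e4 in f1 f2 f3 f4; clear -f1 f2 f3 f4 g1 g2 c1 c2.
    lra.
  - have e1 : f 1%N = 0%N by clear -fs p1 p2; lia.
    have e2 : f 2%N = 0%N by clear -fs p1 p2; lia.
    have e3 : f 3%N = 1%N by clear -fs p1 p2; lia.
    have e4 : f 4%N = 1%N by clear -fs p1 p2; lia.
    rewrite e1 e2 e3 e4 in f1 f2 f3 f4; clear -f1 f2 f3 f4 g1 g2 c1 c2.
    lra.
have {}fs : (f 1 + 1 <= k)%N.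
  by case: pp p1 p2 => [->|[->|->]] p1 p2; clear -fs p1 p2; lia.
have {}fs : (f 1)%:R + 1 <= k%:R :> R by rewrite natr1 ler_nat -addn1.
by move: slope sk f1 fs k3 h1; clear; lra.
Qed.

Lemma slices_half_integral {m k a b h ar f} : slices (2 : R) m k a b h ar f ->
  (3 <= m)%N -> a = 0 \/ a = 1 / 2 -> b = m%:R + 1 / 2 \/ b = m%:R + 1 ->
  ar a b (9 / 4 * (k%:R + 1)).
Proof.
move=> S m3 [a0|a2] [b2|b1].
- exact: slices_unit_half S m3 a0 b2.
- exact: slices_unit_unit S m3 a0 b1.
- exact: slices_half_half S m3 a2 b2.
- have := slices_unit_half (slices_rev S) m3.
  rewrite (_ : m%:R + 1 - (m%:R + 1 - a) = a); last by ring.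
  rewrite (_ : m%:R + 1 - (m%:R + 1 - b) = b); last by ring.
  by apply; lra.
Qed.

End HalfIntegral.

Lemma half_integer_cases {R : realType} (x : R) (i : int) : 2 * x = i%:~R ->
  0 <= x -> x <= 1 -> [\/ x = 0, x = 1 / 2 | x = 1].
Proof.
move=> xi x0 x1.
have i0 : 0 <= i by rewrite -(ler_int R) -xi; lra.
have i2 : i <= 2 by rewrite -(ler_int R) -xi; lra.
have [i_0|[i1|i_2]] : i = 0 \/ i = 1 \/ i = 2 by clear -i0 i2; lia.
- by constructor 1; rewrite i_0 in xi; lra.
- by constructor 2; rewrite i1 in xi; lra.
- by constructor 3; rewrite i_2 in xi; lra.
Qed.

Lemma slices_area {R : realType} {l m k : nat} {a b : R} {h ar f} :
  slices (l%:R : R) m k a b h ar f -> (0 < m)%N ->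
  (exists i : int, l%:R * a = i%:~R) -> (exists i : int, l%:R * b = i%:~R) ->
  ar a b (ratio l%:R * (k%:R + 1)).
Proof.
move=> S m0 [i ai] [j bj].
have [P l2 k2 a0 a1 b0 b1 fh sk _] := S.
have k2R : 2 <= k%:R :> R by rewrite (ler_nat R 2).
have [m3|m2] := leqP 3 m.
  have [l3|l_2] : (3 <= l)%N \/ l = 2%N.
    by move: l2; rewrite (ler_nat R 2); clear; lia.
  - have [m4|m_3] : (4 <= m)%N \/ m = 3%N by clear -m3; lia.
      exact: slices_many S l3 m4.
    by subst m; exact: slices_three S l3.
  - subst l; rewrite (_ : ratio 2%:R = 9 / 4); last by rewrite /ratio; field.
    apply: (slices_half_integral S m3).
    + have [|a_0|a_2|a_1] := half_integer_cases a i ai a0; [lra|by left|by right|].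
      by exfalso; move: a1; rewrite a_1; clear; lra.
    + have [|||b_0|b_2|b_1] := half_integer_cases (b - m%:R) (j - (2 * m)%N%:Z).
      * by rewrite mulrBr bj rmorphB/= -pmulrn natrM.
      * by clear -b0; lra.
      * by clear -b1; lra.
      * by exfalso; move: b0; rewrite b_0; clear; lra.
      * by left; clear -b_2; lra.
      * by right; clear -b_1; lra.
have aa := slices_a_lt1 S. have bb := slices_b_gtm S.
have [m_1|m_2] : m = 1%N \/ m = 2%N by clear -m0 m2; lia.
- subst m; apply: (profile_one_slice P 1) => //; try by (clear -a0 b1; lra).
  apply: le_trans (fh 1 isT) _; rewrite lerD2r ler_nat.
  by move: sk; rewrite big_nat1.
- subst m; apply: (profile_two_slices P _ _ (f 1)%:R (f 2)%:R) => //.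
  + by clear -b1; lra.
  + exact: (fh 1).
  + exact: (fh 2).
  + by rewrite -natrD ler_nat; move: sk; rewrite big_nat_recr//= big_nat1.
Qed.

(** * Areas in the plane *)

Section PlaneMeasure.
Context {R : realType}.
Local Notation mu := (@lebesgue_measure R).
Implicit Types (P : set (R * R)) (A : set R).

Lemma measurable_addr (t : R) : measurable_fun setT (fun y : R => y + t).
Proof. by apply: measurable_funD => //; exact: measurable_cst. Qed.

(** The pushforward under translation agrees with Lebesgue measure on half-open intervals, which
    determine it. *)
Lemma lebesgue_measure_translate (t : R) A : measurable A ->
  mu [set y | A (y + t)] = mu A.
Proof.
move=> mA.
have ms : measurable_fun setT (fun y : measurableTypeR R => (y + t : measurableTypeR R)).
  exact: measurable_addr.
pose nu := pushforward mu (fun y : measurableTypeR R => (y + t : measurableTypeR R)).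
apply/esym; apply: (@lebesgue_measure_unique R nu) => //= _ [[a b]] _ <-.
rewrite /nu /pushforward.
rewrite (_ : _ @^-1` _ = `](a - t), (b - t)]%classic); last first.
  by apply/seteqP; split => y /=; rewrite !in_itv/=; lra.
by rewrite !lebesgue_measure_itv/= !lte_fin ltrD2r -!EFinD; case: ifP => // _;
  congr (_%:E); ring.
Qed.

(** Cavalieri: the section at x is merely translated by c x. *)
Lemma shear_area (c : R) P : measurable P ->
  (mu \x mu)%E [set z | P (z.1, z.2 + c * z.1)] = (mu \x mu)%E P.
Proof.
move=> mP; rewrite /product_measure1; apply: eq_integral => x _ /=.
rewrite -[RHS](lebesgue_measure_translate (c * x)); last exact: measurable_xsection.
congr (mu _); apply/seteqP; split => y /=; by rewrite /xsection/= !inE.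
Qed.

(** The swap exchanges the two orders of integration, which agree because both define a measure with
    the same values on rectangles. *)
Lemma swap_area P : measurable P ->
  (mu \x mu)%E [set z | P (z.2, z.1)] = (mu \x mu)%E P.
Proof.
move=> mP; transitivity ((mu \x^ mu)%E P).
  rewrite /product_measure1 /product_measure2; apply: eq_integral => x _ /=.
  by congr (mu _); apply/seteqP; split => y /=; rewrite /xsection/ysection/= !inE.
apply/esym/product_measure_unique => //= A B mA mB.
by rewrite product_measure2E.
Qed.

Lemma measurable_shear (c : R) P : measurable P ->
  measurable [set z : R * R | P (z.1, z.2 + c * z.1)].
Proof.
move=> mP.
have mf : measurable_fun setT (fun z : R * R => (z.1, z.2 + c * z.1)).
  apply/measurable_fun_pair => //=.
  by apply: measurable_funD => //; apply: measurable_funM.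
by have := mf measurableT P mP; rewrite setTI.
Qed.

Lemma measurable_swap P : measurable P ->
  measurable [set z : R * R | P (z.2, z.1)].
Proof.
move=> mP.
have mf : measurable_fun setT (fun z : R * R => (z.2, z.1)).
  exact: measurable_fun_pair.
by have := mf measurableT P mP; rewrite setTI.
Qed.

Lemma integral_affine (u v c d e : R) : u <= v ->
  (\int[mu]_(x in `[u, v]) (c + d * (x - e))%:E =
   ((v - u) * (c + d * ((u + v) / 2 - e)))%:E)%E.
Proof.
rewrite le_eqVlt => /predU1P[->|uv].
  by rewrite subrr mul0r set_itv1 integral_set1.
pose F (x : R) := c * x + d / 2 * (x - e) ^+ 2.
have dF (x : R) : is_derive x 1 F (c + d * (x - e)).
  rewrite /F; apply: is_derive_eq.
  by rewrite /GRing.scale/=; field.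
have cF : continuous F.
  by move=> x; apply: differentiable_continuous; apply/derivable1_diffP.
rewrite (@continuous_FTC2 _ _ F)//.
- by rewrite -EFinB; congr (_%:E); rewrite /F; field.
- apply: continuous_subspaceT => x.
  by apply: cvgD; [exact: cvg_cst|apply: cvgM; [exact: cvg_cst|
    apply: cvgB; [exact: cvg_id|exact: cvg_cst]]].
- split.
  + by move=> x _.
  + by apply: cvg_at_right_filter; exact: cF.
  + by apply: cvg_at_left_filter; exact: cF.
- by move=> x _; rewrite derive1E; apply: derive_val.
Qed.

Definition strip P (u v : R) : \bar R :=
  (\int[mu]_(x in `[u, v]) mu (xsection P x))%E.

Lemma strip_cat P (u v w : R) : measurable P -> u <= v -> v <= w ->
  (strip P u w <= strip P u v + strip P v w)%E.
Proof.
move=> mP uv vw.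
have mf D : measurable D -> measurable_fun D (fun x => mu (xsection P x)).
  by move=> mD; apply: measurable_funTS; exact: measurable_fun_xsection.
rewrite /strip (_ : `[u, w]%classic = `[u, v]%classic `|` `]v, w]%classic); last first.
  by apply/seteqP; split => x /=; rewrite !in_itv/=; [case: (leP x v)|]; lra.
rewrite ge0_integral_setU//=; last 2 first.
- by apply: mf; exact: measurableU.
- by apply/disj_setPS => x [/=]; rewrite !in_itv/=; lra.
rewrite leeD2l// ge0_subset_integral//; first exact: mf.
by move=> x /=; rewrite !in_itv/=; lra.
Qed.

Lemma strip_affine P (u v c d e : R) : measurable P -> u <= v ->
  (forall x, u <= x <= v -> (mu (xsection P x) <= (c + d * (x - e))%:E)%E) ->
  (strip P u v <= ((v - u) * (c + d * ((u + v) / 2 - e)))%:E)%E.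
Proof.
move=> mP uv H; rewrite -integral_affine// /strip.
apply: ge0_le_integral => //=.
- by apply: measurable_funTS; exact: measurable_fun_xsection.
- apply/measurable_EFinP/measurable_funTS.
  apply: measurable_funD => //; apply: measurable_funM => //.
  exact: measurable_funB.
Qed.

Lemma area_strip P (u v : R) : (forall z, P z -> u <= z.1 <= v) ->
  (mu \x mu)%E P = strip P u v.
Proof.
move=> Puv; rewrite /product_measure1 /strip [RHS]integral_mkcond.
apply: eq_integral => x _ /=; rewrite patchE.
case: ifPn => // xuv; rewrite (_ : xsection P x = set0) ?measure0//.
apply/seteqP; split => y //=; rewrite /xsection/= inE => /Puv/= xin.
by move: xuv; rewrite notin_setE/= in_itv/= xin.
Qed.

(** The sigma-algebra is generated by rectangles, so the open complement is written as a countable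
    union of boxes with rational corners. *)
Lemma closed_measurable_plane P : closed P -> measurable P.
Proof.
move=> cP; rewrite -(setCK P); apply: measurableC.
have oP : open (~` P) by exact: closed_openC.
pose box (q : (rat * rat) * (rat * rat)) : set (R * R) :=
  `]ratr q.1.1, ratr q.1.2[%classic `*` `]ratr q.2.1, ratr q.2.2[%classic.
pose F q := if `[< box q `<=` ~` P >] then box q else set0.
rewrite (_ : ~` P = \bigcup_q F q); last first.
  apply/seteqP; split => [[x y] nP|z [q _]]; last first.
    by rewrite /F; case: ifPn => // /asboolP qP /qP.
  have /nbhs_ballP[e /= e0 He] : nbhs (x, y) (~` P) by exact: open_nbhs_nbhs.
  have /rat_in_itvoo[q1] : x - e < x by lra.
  have /rat_in_itvoo[q2] : x < x + e by lra.
  have /rat_in_itvoo[q3] : y - e < y by lra.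
  have /rat_in_itvoo[q4] : y < y + e by lra.
  rewrite !in_itv/= => h4 h3 h2 h1.
  exists ((q1, q2), (q3, q4)) => //; rewrite /F.
  have -> : `[< box (q1, q2, (q3, q4)) `<=` ~` P >].
    apply/asboolP => -[x' y'] [/=]; rewrite !in_itv/= => hx hy.
    by apply: He; split; rewrite /ball/= ltr_norml; lra.
  by split; rewrite /= in_itv/=; lra.
apply: countable_bigcupT_measurable; first exact: countableP.
move=> q; rewrite /F; case: ifP => // _.
by apply: measurableX; exact: measurable_itv.
Qed.

End PlaneMeasure.

(** * Lattice width *)

Section Bodies.
Context {R : realType}.
Implicit Types (P : set (R * R)) (z : R * R) (l k : nat) (u v p q c : int).

(** The interior, expressed by square neighbourhoods so that shears and the swap act on it by
    explicit inequalities. *)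
Definition inside P z : Prop := exists2 r, 0 < r &
  forall x y, `|x - z.1| <= r -> `|y - z.2| <= r -> P (x, y).

Definition form u v z : R := u%:~R * z.1 + v%:~R * z.2.

Definition convex_plane P := forall y z t, P y -> P z -> 0 <= t <= 1 ->
  P (t * y.1 + (1 - t) * z.1, t * y.2 + (1 - t) * z.2).

(* The properties of a polygon of denominator [l] with [k] interior lattice
   points that the area bound needs: unlike the polygon structure, they are
   visibly preserved by shears and by the swap. *)
Record body l k P : Prop := Body {
  body_convex : convex_plane P;
  body_measurable : measurable P;
  body_max : forall u v, exists z, [/\ P z,
    forall s, P s -> form u v s <= form u v z &
    exists i : int, l%:R * form u v z = i%:~R];
  body_lattice : exists i j : int, inside P (i%:~R, j%:~R);
  body_count : forall s : seq (int * int), uniq s ->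
    (forall w, w \in s -> inside P (w.1%:~R, w.2%:~R)) -> (size s <= k)%N }.

#[global] Arguments body_convex {l k P}.
#[global] Arguments body_measurable {l k P}.
#[global] Arguments body_max {l k P}.
#[global] Arguments body_lattice {l k P}.
#[global] Arguments body_count {l k P}.

Definition shear c P : set (R * R) := [set z | P (z.1, z.2 + c%:~R * z.1)].
Definition swap P : set (R * R) := [set z | P (z.2, z.1)].

Lemma form_shear c u v z :
  form u v z = form (u - c * v) v (z.1, z.2 + c%:~R * z.1).
Proof. by rewrite /form/= rmorphB rmorphM/=; ring. Qed.

Lemma inside_swap P z : inside (swap P) z -> inside P (z.2, z.1).
Proof. by case=> r r0 H; exists r => // x y hx hy; exact: H. Qed.

Lemma shearK c P : shear (- c) (shear c P) = P.
Proof.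
apply/seteqP; split => -[x y]; rewrite /shear/= rmorphN/=;
  by rewrite (_ : y + - c%:~R * x + c%:~R * x = y)//; ring.
Qed.

Lemma inside_shear c P z :
  inside (shear c P) z -> inside P (z.1, z.2 + c%:~R * z.1).
Proof.
case=> r r0 H.
have d0 : 0 < 1 + `|c%:~R : R| by rewrite ltr_wpDr.
(* The shear stretches the sup norm by a factor of at most 1 + |c|. *)
have e0 : 0 < r / (1 + `|c%:~R|) by rewrite divr_gt0.
have er : r / (1 + `|c%:~R|) * (1 + `|c%:~R|) = r by rewrite divfK// gt_eqF.
exists (r / (1 + `|c%:~R|)) => // x y /= hx hy.
move: (r / _) e0 er hx hy => e e0 er hx hy.
have ec : 0 <= e * `|c%:~R| by rewrite mulr_ge0// ltW.
have xc : `|c%:~R * (x - z.1)| <= e * `|c%:~R|.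
  by rewrite normrM mulrC ler_wpM2r.
have := H x (y - c%:~R * x); rewrite /shear/= subrK; apply.
  by move: hx er ec; clear; lra.
rewrite (_ : y - c%:~R * x - z.2 =
  (y - (z.2 + c%:~R * z.1)) - c%:~R * (x - z.1)); last by ring.
apply: le_trans (ler_normB _ _) _.
by move: hy xc er; clear; lra.
Qed.

Lemma body_shear {l k P} c : body l k P -> body l k (shear c P).
Proof.
case=> cv me mx [i [j ij]] ct; split.
- move=> y z t Py Pz t01; have := cv _ _ t Py Pz t01; rewrite /shear/=.
  by congr (P (_, _)); ring.
- exact: measurable_shear.
- move=> u v; have [z [Pz zmax [n zn]]] := mx (u - c * v) v.
  exists (z.1, z.2 - c%:~R * z.1).
  have zE : (z.1, z.2 - c%:~R * z.1 + c%:~R * z.1) = z.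
    by rewrite subrK; case: (z).
  split.
  + by rewrite /shear/= zE.
  + by move=> s Ps; rewrite (form_shear c u v s) (form_shear c u v (z.1, _)) /= zE; exact: zmax.
  + by exists n; rewrite (form_shear c) /= zE.
- exists i, (j - c * i); rewrite rmorphB rmorphM/=.
  have := @inside_shear (- c) (shear c P) (i%:~R, j%:~R).
  by rewrite shearK /= rmorphN/= mulNr; exact.
- move=> s us Hs.
  rewrite -(size_map (fun w : int * int => (w.1, w.2 + c * w.1)) s); apply: ct.
    rewrite map_inj_uniq// => -[x1 y1] [x2 y2] [-> ]; by move=> /addIr ->.
  move=> _ /mapP[w ws ->] /=; rewrite rmorphD rmorphM/=.
  exact: (@inside_shear _ _ (w.1%:~R, w.2%:~R) (Hs w ws)).
Qed.

Lemma body_swap {l k P} : body l k P -> body l k (swap P).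
Proof.
case=> cv me mx [i [j ij]] ct; split.
- by move=> y z t Py Pz t01; exact: cv _ _ t Py Pz t01.
- exact: measurable_swap.
- move=> u v; have [z [Pz zmax [n zn]]] := mx v u.
  have fE s : form u v s = form v u (s.2, s.1) by rewrite /form/= addrC.
  exists (z.2, z.1); rewrite /swap/= fE/=.
  have zE : (z.1, z.2) = z by case: (z).
  rewrite zE; split => //; last by exists n.
  by move=> s Ps; rewrite (fE s); exact: zmax.
- by case: ij => r r0 H; exists j, i, r => // x y hx hy; exact: H.
- move=> s us Hs.
  rewrite -(size_map (fun w : int * int => (w.2, w.1)) s); apply: ct.
    by rewrite map_inj_uniq// => -[x1 y1] [x2 y2] [-> ->].
  by move=> _ /mapP[w ws ->] /=; exact: (inside_swap _ _ (Hs w ws)).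
Qed.

(* [P] attains its smallest width among nonzero integral forms at [form p q]. *)
Definition thinnest P p q : Prop := forall u v, (u, v) <> (0, 0) ->
  exists y z, [/\ P y, P z & forall s t, P s -> P t ->
    form p q s - form p q t <= form u v y - form u v z].

Lemma thinnest_shear c P p q :
  thinnest P p q -> thinnest (shear c P) (p + c * q) q.
Proof.
move=> T u v uv0.
have [|y [z [Py Pz H]]] := T (u - c * v) v.
  by move=> [uv v0]; apply: uv0; rewrite -(subrK (c * v) u) uv v0 mulr0 addr0.
exists (y.1, y.2 - c%:~R * y.1), (z.1, z.2 - c%:~R * z.1).
have zE (s : R * R) : (s.1, s.2 - c%:~R * s.1 + c%:~R * s.1) = s.
  by rewrite subrK; case: (s).
split; [by rewrite /shear/= zE|by rewrite /shear/= zE|].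
move=> s t Ps Pt; rewrite (form_shear c (p + _) _ s) (form_shear c (p + _) _ t) addrK.
by rewrite !(form_shear c u v (_, _))/= !zE; exact: H.
Qed.

Lemma thinnest_swap P p q : thinnest P p q -> thinnest (swap P) q p.
Proof.
move=> T u v uv0.
have fE a b s : form a b s = form b a (s.2, s.1) by rewrite /form/= addrC.
have [|y [z [Py Pz H]]] := T v u.
  by move=> [v0 u0]; apply: uv0; rewrite u0 v0.
exists (y.2, y.1), (z.2, z.1).
have zE (s : R * R) : (s.1, s.2) = s by case: (s).
split; [by rewrite /swap/= zE|by rewrite /swap/= zE|].
move=> s t Ps Pt; rewrite (fE q p s) (fE q p t).
by rewrite (fE u v (_, _)) (fE u v (z.2, _))/= !zE; exact: H.
Qed.

(** The extreme values of an integral form on [P] lie in (1/l) Z, so [l] times its width is a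
    natural number, and a least one exists. *)
Lemma thinnest_exists {l k P} : (0 < l)%N -> body l k P ->
  exists p q, (p, q) <> (0, 0) /\ thinnest P p q.
Proof.
move=> l0 B; have l0R : 0 < l%:R :> R by rewrite ltr0n.
pose Q (n : nat) := exists p q, (p, q) <> (0, 0) /\ exists y z,
  [/\ P y, P z, forall s t, P s -> P t -> form p q s - form p q t <= form p q y - form p q z
   & l%:R * (form p q y - form p q z) = n%:R].
have wQ p q : (p, q) <> (0, 0) -> exists y z n, [/\ P y, P z,
     forall s t, P s -> P t -> form p q s - form p q t <= form p q y - form p q z
   & l%:R * (form p q y - form p q z) = n%:R].
  move=> pq0; have [y [Py ymax [i yi]]] := body_max B p q.
  have [z [Pz zmax [j zj]]] := body_max B (- p) (- q).
  have fN s : form (- p) (- q) s = - form p q s.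
    by rewrite /form !rmorphN/=; ring.
  exists y, z, (absz (i + j)); split => //.
  - move=> s t Ps Pt; have := ymax s Ps; have := zmax t Pt.
    by rewrite !fN; clear; lra.
  - rewrite fN in zj.
    have e : l%:R * (form p q y - form p q z) = (i + j)%:~R.
      by rewrite rmorphD/= -yi -zj; ring.
    rewrite e natr_absz ger0_norm// -(ler_int R) -e.
    by rewrite mulr_ge0// subr_ge0; exact: ymax.
have exQ : exists n, `[< Q n >].
  have [|y [z [n H]]] := wQ 1 0; first by [].
  by exists n; apply/asboolP; exists 1, 0; split => //; exists y, z.
case: (ex_minnP exQ) => n /asboolP[p [q [pq0 [y [z [Py Pz H Hn]]]]]] nmin.
exists p, q; split => // u v uv0.
have [y' [z' [n' [Py' Pz' H' Hn']]]] := wQ u v uv0.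
exists y', z'; split => // s t Ps Pt; apply: le_trans (H s t Ps Pt) _.
rewrite -(ler_pM2l l0R) Hn Hn' ler_nat; apply: nmin.
by apply/asboolP; exists u, v; split => //; exists y', z'.
Qed.

(** The width along (p, 0) is |p| times the width along (1, 0), so no coprimality of the minimal
    form is required. *)
Lemma thinnest_horizontal P p : p <> 0 -> thinnest P p 0 -> thinnest P 1 0.
Proof.
move=> p0 T u v uv0; have [y [z [Py Pz H]]] := T u v uv0.
exists y, z; split => // s t Ps Pt.
have := H _ _ Ps Pt; have := H _ _ Pt Ps; have := H _ _ Ps Ps.
move: (form u v y - form u v z) => w; rewrite /form !mul0r !addr0 !mul1r subrr.
rewrite -!mulrBr; set d := s.1 - t.1; rewrite -(opprB s.1) -/d => w0 H1 H2.
have [d0|d0] := lerP d 0; first exact: le_trans w0.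
have [pn|pp] := lerP p 0.
  have : (p%:~R : R) <= (-1)%:~R by rewrite ler_int; lia.
  rewrite rmorphN1 => p1; have : 0 <= (- 1 - p%:~R) * d by rewrite mulr_ge0; lra.
  by move: H1; clear; lra.
have p1 : 1 <= (p%:~R : R) by rewrite ler1z; lia.
have : 0 <= (p%:~R - 1) * d by rewrite mulr_ge0; lra.
by move: H2; clear; lra.
Qed.

(** Descent on |p| + |q|: a shear subtracts the smaller coefficient from the larger in absolute
    value, and a swap restores their order, until one of them is 0. *)
Lemma thinnest_transport (Q : set (R * R) -> Prop) :
  (forall c P, Q (shear c P) -> Q P) -> (forall P, Q (swap P) -> Q P) ->
  forall l k, (forall P, body l k P -> thinnest P 1 0 -> Q P) ->
  forall P p q, body l k P -> (p, q) <> (0, 0) -> thinnest P p q -> Q P.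
Proof.
move=> Qshear Qswap l k Q0 P p q.
have [n] := ubnP (absz p + absz q)%N.
elim: n P p q => // n IH P p q pq B pq0 T.
have [q0|q0] := eqVneq q 0.
  by apply: Q0 B _; apply: thinnest_horizontal (_ : p <> 0) _; [move=> p0; apply: pq0;
    rewrite p0 q0|rewrite -q0].
have [p0|p0] := eqVneq p 0.
  apply/Qswap/(Q0 _ (body_swap B)).
  apply: (thinnest_horizontal _ q); first exact/eqP.
  by rewrite -p0; exact: thinnest_swap.
have step P' p' q' : body l k P' -> thinnest P' p' q' -> p' != 0 -> q' != 0 ->
    (absz q' <= absz p')%N -> (absz p' + absz q' < n.+1)%N -> Q P'.
  move=> B' T' p'0 q'0 qp' pq'.
  (* The sign is chosen so that |p' + c q'| = |p'| - |q'|. *)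
  pose c : int := if (0 < p') == (0 < q') then -1 else 1.
  apply: (Qshear c); apply: (IH _ (p' + c * q') q') (body_shear c B') _ _.
  - by rewrite /c; case: ifP; lia.
  - by move=> [_ /eqP]; apply/negP.
  - exact: thinnest_shear.
have [qp|pq'] := leqP (absz q) (absz p); first exact: (step P p q).
apply: Qswap; apply: (step _ q p) => //.
- exact: body_swap.
- exact: thinnest_swap.
- exact: ltnW.
- by rewrite addnC.
Qed.

End Bodies.

(** * Slices of a convex body *)

Section SliceLength.
Context {R : realType}.
Local Notation mu := (@lebesgue_measure R).
Implicit Types (P : set (R * R)) (z : R * R) (l k : nat) (u v p q c : int).

Definition chords P (x : R) : set R :=
  [set d | exists y1 y2, [/\ P (x, y1), P (x, y2) & d = y1 - y2]].

(** A supremum of chords rather than a measure: concavity follows by mixing chords, and a long slice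
    yields an actual chord on which to find lattice points. *)
Definition slice_length P (x : R) : R := sup (chords P x).

Lemma convex_mix {P} x1 y1 x2 y2 x : convex_plane P -> P (x1, y1) -> P (x2, y2) ->
  x1 <= x <= x2 -> x1 < x2 ->
  P (x, ((x2 - x) * y1 + (x - x1) * y2) / (x2 - x1)).
Proof.
move=> cv P1 P2 xx x12; have x0 : 0 < x2 - x1 by rewrite subr_gt0.
have := cv _ _ ((x2 - x) / (x2 - x1)) P1 P2.
have t01 : 0 <= (x2 - x) / (x2 - x1) <= 1.
  by rewrite ler_pdivlMr// ler_pdivrMr// mul0r mul1r; lra.
by move=> /(_ t01); congr (P (_, _)); rewrite /=; field; rewrite gt_eqF.
Qed.

Lemma convex_vertical {P} x y1 y2 y : convex_plane P -> P (x, y1) -> P (x, y2) ->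
  y2 <= y <= y1 -> P (x, y).
Proof.
move=> cv P1 P2 yy; have [y12|y12] := leP y1 y2.
  by rewrite (_ : y = y1)//; lra.
have y0 : 0 < y1 - y2 by rewrite subr_gt0.
have := cv _ _ ((y - y2) / (y1 - y2)) P1 P2.
have t01 : 0 <= (y - y2) / (y1 - y2) <= 1.
  by rewrite ler_pdivlMr// ler_pdivrMr// mul0r mul1r; lra.
by move=> /(_ t01); congr (P (_, _)); rewrite /=; field; rewrite gt_eqF.
Qed.

Section Bounded.
Context (P : set (R * R)) (H : R) (cv : convex_plane P) (mP : measurable P)
  (bd : forall x y1 y2, P (x, y1) -> P (x, y2) -> y1 - y2 <= H).

Lemma chords_ub x : has_ubound (chords P x).
Proof. by exists H => _ [y1 [y2 [P1 P2 ->]]]; exact: bd P2. Qed.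

Lemma chord_le x y1 y2 : P (x, y1) -> P (x, y2) -> y1 - y2 <= slice_length P x.
Proof. by move=> P1 P2; apply: (ub_le_sup (chords_ub x)); exists y1, y2. Qed.

Lemma chords_nonempty x y : P (x, y) -> chords P x !=set0.
Proof. by move=> Py; exists (y - y), y, y. Qed.

Lemma slice_length_ge0 x : 0 <= slice_length P x.
Proof.
(* An abscissa that misses [P] has no chords, and [sup] of the empty set is 0. *)
have [e|/set0P[d [y [_ [Py _ _]]]]] := eqVneq (chords P x) set0.
  by rewrite /slice_length e sup0.
by rewrite -(subrr y); exact: chord_le.
Qed.

Lemma slice_length_gt x t : 0 <= t -> t < slice_length P x ->
  exists y1 y2, [/\ P (x, y1), P (x, y2) & t < y1 - y2].
Proof.
move=> t0 tx; have [e|/set0P ne] := eqVneq (chords P x) set0.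
  by move: tx; rewrite /slice_length e sup0; lra.
by have [d [y1 [y2 [P1 P2 ->]]] ty] := sup_gt ne tx; exists y1, y2.
Qed.

Lemma slice_length_concave (x y z a b : R) : P (x, a) -> P (z, b) -> x <= y -> y <= z ->
  (z - y) * slice_length P x + (y - x) * slice_length P z
    <= (z - x) * slice_length P y.
Proof.
move=> Pa Pb; rewrite le_eqVlt => /predU1P[->|xy].
  by rewrite subrr mul0r addr0.
rewrite le_eqVlt => /predU1P[->|yz]; first by rewrite subrr mul0r add0r.
have zy : 0 < z - y by rewrite subr_gt0.
have yx : 0 < y - x by rewrite subr_gt0.
have zx : 0 < z - x by lra.
have key d d' : chords P x d -> chords P z d' ->
    (z - y) * d + (y - x) * d' <= (z - x) * slice_length P y.
  move=> [y1 [y2 [P1 P2 ->]]] [z1 [z2 [Q1 Q2 ->]]].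
  have M1 := convex_mix _ _ _ _ y cv P1 Q1 ltac:(lra) ltac:(lra).
  have M2 := convex_mix _ _ _ _ y cv P2 Q2 ltac:(lra) ltac:(lra).
  have := chord_le _ _ _ M1 M2.
  by rewrite -mulrBl ler_pdivrMr// (mulrC (slice_length _ _)); lra.
have key2 d' : chords P z d' ->
    (z - y) * slice_length P x + (y - x) * d' <= (z - x) * slice_length P y.
  move=> zd'; rewrite -lerBrDr -ler_pdivlMl//.
  apply: ge_sup => [|d xd]; first exact: chords_nonempty Pa.
  by rewrite ler_pdivlMl// lerBrDr; exact: key.
rewrite -lerBrDl -ler_pdivlMl//.
apply: ge_sup => [|d zd]; first exact: chords_nonempty Pb.
by rewrite ler_pdivlMl// lerBrDl; exact: key2.
Qed.

(** The section lies in the interval of length [slice_length P x] that ends at its supremum; only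
    this inequality is required. *)
Lemma slice_measure_le x : (mu (xsection P x) <= (slice_length P x)%:E)%E.
Proof.
have [->|/set0P[y0]] := eqVneq (xsection P x) set0.
  by rewrite measure0 lee_fin slice_length_ge0.
rewrite /xsection/= inE => Py0.
pose S := [set y | P (x, y)].
have S0 : S !=set0 by exists y0.
have Sub y : P (x, y) -> ubound S (y + slice_length P x).
  by move=> Py y' Py'; have := chord_le _ _ _ Py' Py; lra.
have hS : has_ubound S by exists (y0 + slice_length P x); exact: Sub.
have sub : xsection P x `<=` `[sup S - slice_length P x, sup S]%classic.
  move=> y; rewrite /xsection/= inE => Py; rewrite in_itv/=; apply/andP; split.
    by rewrite lerBlDr; apply: ge_sup => //; exact: Sub.
  exact: ub_le_sup.
apply: (@le_trans _ _ (mu `[sup S - slice_length P x, sup S]%classic)).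
  by apply: le_measure => //; rewrite inE; [exact: measurable_xsection|exact: measurable_itv].
rewrite lebesgue_measure_itv/= lte_fin; case: ifP => _.
  by rewrite -EFinB lee_fin; lra.
by rewrite lee_fin slice_length_ge0.
Qed.

End Bounded.

(** Moving the chord [y2, y1] towards (b, yb) by a fraction t shifts its ends by at most t |yb - y1|
    and t |yb - y2|. The radius forces t <= d / (2 K), so these shifts and the vertical displacement
    are each at most d/2, half the clearance of y. The sign condition says that x' is on the side of
    b. *)
Lemma convex_near_side P x y y1 y2 b yb : convex_plane P ->
  P (x, y1) -> P (x, y2) -> P (b, yb) -> y2 < y -> y < y1 -> x != b ->
  exists2 r, 0 < r & forall x' y', 0 <= (x' - x) / (b - x) ->
    `|x' - x| <= r -> `|y' - y| <= r -> P (x', y').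
Proof.
move=> cv P1 P2 Pb yy2 yy1 xb.
have D0 : 0 < `|b - x| by rewrite normr_gt0 subr_eq0 eq_sym.
have bx0 : b - x != 0 by rewrite subr_eq0 eq_sym.
pose d := Num.min (y1 - y) (y - y2).
have d0 : 0 < d by rewrite /d lt_min !subr_gt0 yy1.
have [d1 d2] : d <= y1 - y /\ d <= y - y2 by rewrite /d !ge_min !lexx orbT.
pose K := `|b - x| + `|yb - y1| + `|yb - y2| + d.
have [B1 B2] : 0 <= `|yb - y1| /\ 0 <= `|yb - y2| by [].
have K0 : 0 < K by rewrite /K; lra.
have r0 : 0 < d * `|b - x| / (2 * K) by rewrite divr_gt0 ?mulr_gt0.
exists (d * `|b - x| / (2 * K)) => // x' y' t0 hx hy.
set t := (x' - x) / (b - x) in t0.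
have x'E : x' = (1 - t) * x + t * b by rewrite /t; field.
have tE : `|x' - x| = t * `|b - x|.
  by rewrite -(ger0_norm t0) -normrM /t divfK.
have tK : t * (2 * K) <= d.
  by move: hx; rewrite tE ler_pdivlMr; [|lra]; rewrite mulrAC ler_pM2r.
have rK : d * `|b - x| / (2 * K) <= d / 2.
  rewrite ler_pdivrMr; last lra.
  have : 0 <= d * (K - `|b - x|) by rewrite mulr_ge0//; rewrite /K; lra.
  by clear; lra.
have t1 : t <= 1.
  rewrite -(ler_pM2r K0) mul1r; have : d <= K by rewrite /K; lra.
  by move: tK K0; clear; lra.
have tB1 : t * `|yb - y1| <= d / 2.
  have : 0 <= t * (K - `|yb - y1|) by rewrite mulr_ge0// /K; lra.
  by move: tK; clear; lra.
have tB2 : t * `|yb - y2| <= d / 2.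
  have : 0 <= t * (K - `|yb - y2|) by rewrite mulr_ge0// /K; lra.
  by move: tK; clear; lra.
have Q1 := cv _ _ t Pb P1 ltac:(lra); have Q2 := cv _ _ t Pb P2 ltac:(lra).
rewrite /= in Q1 Q2.
have xE : t * b + (1 - t) * x = x' by rewrite x'E addrC.
rewrite xE in Q1 Q2; apply: (convex_vertical _ _ _ _ cv Q1 Q2).
have : t * (y1 - yb) <= t * `|yb - y1| by rewrite ler_wpM2l// distrC ler_norm.
have : t * (yb - y2) <= t * `|yb - y2| by rewrite ler_wpM2l// ler_norm.
move: hy; rewrite ler_norml => /andP[hy1 hy2].
by move: rK tB1 tB2 d1 d2 hy1 hy2; clear; lra.
Qed.

Lemma convex_inside P x y y1 y2 a ya b yb : convex_plane P ->
  P (x, y1) -> P (x, y2) -> P (a, ya) -> P (b, yb) ->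
  y2 < y -> y < y1 -> a < x -> x < b -> inside P (x, y).
Proof.
move=> cv P1 P2 Pa Pb yy2 yy1 ax xb.
have [r r0 Hr] := convex_near_side _ _ _ _ _ _ _ cv P1 P2 Pb yy2 yy1 (negbT (lt_eqF xb)).
have [s s0 Hs] := convex_near_side _ _ _ _ _ _ _ cv P1 P2 Pa yy2 yy1 (negbT (gt_eqF ax)).
exists (Num.min r s); first by rewrite lt_min r0.
move=> x' y' /=; rewrite !le_min => /andP[xr xs] /andP[yr ys].
have [xx|xx] := leP x x'.
- by apply: Hr => //; rewrite divr_ge0; lra.
- by apply: Hs => //; rewrite -mulrNN -invrN mulr_ge0 ?invr_ge0; lra.
Qed.

End SliceLength.

(** * From a body of minimal horizontal width to its slices *)

Section BodyArea.
Context {R : realType}.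
Local Notation mu := (@lebesgue_measure R).
Implicit Types (P : set (R * R)) (l k : nat) (u v p q c : int).

(* If all vertical chords had length at most [t], the difference set [P - P]
   would lie between two parallel lines [y = s * x + t] and [y = s * x - t]; for
   an integer [c] nearest to [s], the width of [P] along [(- c, 1)] would be at
   most [t + w / 2 < w]. *)
Lemma long_chord P a b ya yb : convex_plane P -> P (a, ya) -> P (b, yb) -> a < b ->
  (forall s, P s -> a <= s.1 <= b) ->
  (forall c : int, exists y z, [/\ P y, P z &
     b - a <= form (- c) 1 y - form (- c) 1 z]) ->
  forall t, t < (b - a) / 2 -> exists x y1 y2, [/\ P (x, y1), P (x, y2) & t < y1 - y2].
Proof.
move=> cv Pa Pb ab Pab wide t tw; apply: contrapT => /forallNP noc.
have short x y1 y2 : P (x, y1) -> P (x, y2) -> y1 - y2 <= t.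
  move=> P1 P2; rewrite leNgt; apply/negP => ty; apply: (noc x).
  by exists y1, y2.
(* These are the lower bounds that the line y = s x + t imposes on s; [key] compares them with the
   upper bounds imposed by y = s x - t. *)
pose S := [set s | exists y z, [/\ P y, P z, z.1 < y.1 &
   s = (y.2 - z.2 - t) / (y.1 - z.1)]].
have S0 : S !=set0.
  by exists ((yb - ya - t) / (b - a)), (b, yb), (a, ya); split.
have key y z y' z' : P y -> P z -> P y' -> P z' -> z.1 < y.1 -> z'.1 < y'.1 ->
    (y.2 - z.2 - t) / (y.1 - z.1) <= (t + (y'.2 - z'.2)) / (y'.1 - z'.1).
  move=> Py Pz Py' Pz' zy zy'.
  have D0 : 0 < y.1 - z.1 by rewrite subr_gt0.
  have D0' : 0 < y'.1 - z'.1 by rewrite subr_gt0.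
  have DD : 0 < y.1 - z.1 + (y'.1 - z'.1) by rewrite addr_gt0.
  (* With this weight the mixture of y with z' and that of z with y' have the same abscissa, so they
     span a vertical chord, of length at most t. *)
  pose lam := (y'.1 - z'.1) / (y.1 - z.1 + (y'.1 - z'.1)).
  have l01 : 0 <= lam <= 1.
    by rewrite /lam ler_pdivlMr// ler_pdivrMr// mul0r mul1r; lra.
  have A := cv _ _ _ Py Pz' l01; have B := cv _ _ _ Pz Py' l01.
  have e : lam * y.1 + (1 - lam) * z'.1 = lam * z.1 + (1 - lam) * y'.1.
    by rewrite /lam; field; rewrite gt_eqF.
  rewrite ler_pdivrMr// [leRHS]mulrAC ler_pdivlMr//.
  rewrite e in A; have := short _ _ _ A B.
  rewrite (_ : _ - _ = ((y'.1 - z'.1) * (y.2 - z.2) - (y.1 - z.1) * (y'.2 - z'.2)) /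
    (y.1 - z.1 + (y'.1 - z'.1))); last first.
    by rewrite /lam; field; rewrite gt_eqF.
  by rewrite ler_pdivrMr//; clear; lra.
have Sub : has_ubound S.
  exists ((t + (yb - ya)) / (b - a)) => _ [y [z [Py Pz zy ->]]].
  exact: (key y z (b, yb) (a, ya)).
pose s := sup S.
have up y z : P y -> P z -> z.1 < y.1 -> y.2 - z.2 <= t + s * (y.1 - z.1).
  move=> Py Pz zy; have : (y.2 - z.2 - t) / (y.1 - z.1) <= s.
    by apply: (ub_le_sup Sub); exists y, z; split.
  by rewrite ler_pdivrMr ?subr_gt0//; lra.
have dn y z : P y -> P z -> z.1 < y.1 -> z.2 - y.2 <= t - s * (y.1 - z.1).
  move=> Py Pz zy; have : s <= (t + (y.2 - z.2)) / (y.1 - z.1).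
    by apply: ge_sup => // _ [y' [z' [Py' Pz' zy' ->]]]; exact: key.
  by rewrite ler_pdivlMr ?subr_gt0//; lra.
pose c := Num.floor (s + 1 / 2).
have /andP[c1 c2] := floor_itv (s + 1 / 2); rewrite -/c in c1 c2.
have [y [z [Py Pz]]] := wide c.
rewrite /form rmorphN/= !mul1r intrD in c2 * => yz.
have [y1 z1] := (Pab _ Py, Pab _ Pz).
have sc : -1 / 2 <= s - c%:~R <= 1 / 2 by lra.
have [zy|yz1|e] := ltgtP z.1 y.1.
- have := up _ _ Py Pz zy.
  have : 0 <= (1 / 2 - (s - c%:~R)) * (y.1 - z.1) by rewrite mulr_ge0; lra.
  by move: yz y1 z1 tw; clear; lra.
- have := dn _ _ Pz Py yz1.
  have : 0 <= (1 / 2 + (s - c%:~R)) * (z.1 - y.1) by rewrite mulr_ge0; lra.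
  by move: yz y1 z1 tw; clear; lra.
- have Py' : P (y.1, y.2) by case: (y) Py.
  have Pz' : P (y.1, z.2) by rewrite -e; case: (z) Pz.
  have := short _ _ _ Py' Pz'; rewrite e in yz.
  by move: yz ab tw; clear; lra.
Qed.

(** For positive x this n is the ceiling of x minus 1, the number of lattice points guaranteed
    strictly inside a chord of length x; at x = 0 it is 0. *)
Lemma pred_ceil_nat (x : R) : 0 <= x -> exists n : nat, x <= n%:R + 1 /\ (n = 0%N \/ n%:R < x).
Proof.
move=> x0; have /andP[h1 h2] := truncn_itv x0; move: h1 h2.
case: (Num.truncn x) => [|n] h1 h2.
  by exists 0%N; split; [move: h2; clear; lra|left].
move: h1 h2; rewrite -!natr1 => h1 h2.
have [e|ne] := eqVneq x (n%:R + 1).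
  by exists n; split; [rewrite e|right; rewrite e ltrDl].
exists n.+1; rewrite -natr1; split; first exact: ltW.
by right; rewrite lt_neqAle eq_sym ne.
Qed.

Lemma body_slices_count {l k P} (N : int) (m : nat) (f : nat -> nat) :
  body l k P ->
  (forall j : nat, (0 < j <= m)%N -> exists g : int, forall i : nat, (i < f j)%N ->
     inside P ((N + j%:Z)%:~R, (g + i%:Z)%:~R)) ->
  (\sum_(1 <= j < m.+1) f j <= k)%N.
Proof.
move=> B H.
have /choice[g Hg] : forall j : nat, exists g : int, (0 < j <= m)%N ->
    forall i : nat, (i < f j)%N -> inside P ((N + j%:Z)%:~R, (g + i%:Z)%:~R).
  move=> j; have [jm|jm] := boolP (0 < j <= m)%N; last by exists 0.
  by have [g Hg] := H j jm; exists g.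
pose s := [seq (N + j%:Z, g j + i%:Z) | j <- index_iota 1 m.+1, i <- iota 0 (f j)].
have -> : (\sum_(1 <= j < m.+1) f j)%N = size s.
  rewrite size_allpairs_dep sumnE big_map; apply: eq_bigr => j _.
  by rewrite size_iota.
apply: (body_count B).
  apply: allpairs_uniq_dep => //; [exact: iota_uniq|by move=> j _; exact: iota_uniq|].
  move=> [j i] [j' i'] /= _ _ [].
  by move=> /addrI [->] /addrI [->].
move=> w /allpairsPdep[j [i [jm im ->]]] /=.
by apply: Hg; [rewrite mem_index_iota in jm|rewrite mem_iota in im].
Qed.

Lemma body_slice_points {l k P} a b ya yb (x : int) (n : nat) : body l k P ->
  P (a, ya) -> P (b, yb) -> a < x%:~R -> x%:~R < b ->
  n%:R < slice_length P x%:~R ->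
  exists g : int, forall i : nat, (i < n)%N -> inside P (x%:~R, (g + i%:Z)%:~R).
Proof.
move=> B Pa Pb ax xb nx.
have [y1 [y2 [P1 P2 ny]]] := slice_length_gt _ _ _ (ler0n R n) nx.
(* The first integer strictly above y2; the n integers from there on are at most y2 + n < y1. *)
exists (Num.floor y2 + 1) => i im.
have /andP[g1 g2] := floor_itv y2.
apply: (convex_inside _ _ _ _ _ _ _ _ _ (body_convex B) P1 P2 Pa Pb) => //.
  by rewrite intrD; apply: lt_le_trans g2 _; rewrite lerDl ler0z.
have : i%:R + 1 <= n%:R :> R by rewrite natr1 ler_nat.
by rewrite !intrD -pmulrn; move: g1 ny; clear; lra.
Qed.

Lemma integer_pos_ge1 (x : R) (i : int) : x = i%:~R -> 0 < x -> 1 <= x.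
Proof. by move=> ->; rewrite ltr0z ler1z; lia. Qed.

Lemma body_area_horizontal {l k P} : (2 <= l)%N -> (2 <= k)%N ->
  body l k P -> thinnest P 1 0 ->
  ((mu \x mu) P <= (ratio l%:R * (k%:R + 1))%:E)%E.
Proof.
move=> l2 k2 B T.
have l2R : 2 <= l%:R :> R by rewrite (ler_nat R 2).
have [[b yb] [Pb bmax [ib lb]]] := body_max B 1 0.
have [[a ya] [Pa amax [ia la]]] := body_max B (-1) 0.
have [[x1 top] [Pt tmax _]] := body_max B 0 1.
have [[x2 bot] [Pbt bmin _]] := body_max B 0 (-1).
have bd x y1 y2 : P (x, y1) -> P (x, y2) -> y1 - y2 <= top - bot.
  move=> /tmax + /bmin; rewrite /form/= !mul0r !add0r.
  by rewrite rmorphN1 !mul1r; clear; lra.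
have {}amax s : P s -> a <= s.1.
  by move=> /amax; rewrite /form/= !mul0r !addr0 rmorphN1; clear; lra.
have {}bmax s : P s -> s.1 <= b.
  by move=> /bmax; rewrite /form/= !mul0r !addr0 !mul1r.
rewrite /form/= !mul0r !addr0 mul1r in lb.
rewrite /form/= !mul0r !addr0 rmorphN1 mulN1r in la.
have [i0 [j0 [r r0 Hr]]] := body_lattice B.
have ai : a < i0%:~R.
  have /amax/= : P (i0%:~R - r, j0%:~R).
    by apply: Hr; rewrite ?subrr ?normr0 ?(ltW r0)// addrAC subrr add0r normrN gtr0_norm.
  by move: r0; clear; lra.
have ib0 : i0%:~R < b.
  have /bmax/= : P (i0%:~R + r, j0%:~R).
    by apply: Hr; rewrite ?subrr ?normr0 ?(ltW r0)// addrAC subrr add0r gtr0_norm.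
  by move: r0; clear; lra.
have ab : a < b := lt_trans ai ib0.
(* Translating by N puts the left end in [0, 1). Then m = ceil (b - N) - 1 is the last integer
   strictly below b - N, and the interior lattice point makes it positive. *)
pose N := Num.floor a; have /andP[N1 N2] := floor_itv a; rewrite -/N in N1 N2.
rewrite intrD in N2.
have Ni : N < i0 by rewrite -(ltr_int R); exact: le_lt_trans N1 ai.
have bN0 : 0 < b - N%:~R by rewrite subr_gt0; apply: le_lt_trans N1 ab.
pose M := Num.ceil (b - N%:~R); have /andP[M1 M2] := ceil_itv (b - N%:~R).
rewrite -/M intrB in M1; rewrite -/M in M2.
have M2' : 1 < M.
  have : (i0 - N)%:~R < M%:~R :> R.
    by apply: lt_le_trans M2; rewrite intrB ltrD2r.
  by rewrite ltr_int; move: Ni; clear; lia.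
pose m := absz (M - 1).
have mM : m%:Z = M - 1 by rewrite /m; move: M2'; clear; lia.
have m0 : (0 < m)%N by rewrite /m; move: M2'; clear; lia.
have mR : m%:R = M%:~R - 1 :> R by rewrite [LHS]pmulrn mM intrB.
have /choice[f Hf] : forall j : nat, exists n : nat,
    slice_length P (N + j%:Z)%:~R <= n%:R + 1 /\
    (n = 0%N \/ n%:R < slice_length P (N + j%:Z)%:~R).
  by move=> j; apply: pred_ceil_nat; exact: (slice_length_ge0 _ _ bd).
pose h (x : R) := slice_length P (N%:~R + x).
pose ar (u v A : R) := (strip P (N%:~R + u) (N%:~R + v) <= A%:E)%E.
have NK (u v : R) : N%:~R + u - (N%:~R + v) = u - v by ring.
have cv := body_convex B; have mP := body_measurable B.
have pt x : a <= x <= b -> P (x, ((b - x) * ya + (x - a) * yb) / (b - a)).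
  by move=> xab; exact: convex_mix.
have Pf : profile (a - N%:~R) (b - N%:~R) h ar.
  split.
  - by rewrite ltrD2r.
  - by move=> x _; exact: (slice_length_ge0 _ _ bd).
  - move=> x y z ax xy yz zb.
    have Px := pt (N%:~R + x) ltac:(clear -ax xy yz zb; lra).
    have Pz := pt (N%:~R + z) ltac:(clear -ax xy yz zb; lra).
    have := slice_length_concave _ _ cv bd _ (N%:~R + y) _ _ _ Px Pz
      ltac:(clear -xy; lra) ltac:(clear -yz; lra).
    by rewrite /h !NK.
  - move=> u v w A1 A2 uv vw H1 H2; apply: le_trans (strip_cat _ _ _ _ mP _ _)
      (leeD H1 H2); by rewrite lerD2l.
  - move=> u v e c d au uv vb H.
    have := strip_affine P (N%:~R + u) (N%:~R + v) c d (N%:~R + e) mP.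
    rewrite lerD2l => /(_ uv) HH; apply: le_trans (HH _) _.
      move=> x xuv; apply: le_trans (slice_measure_le _ _ mP bd _) _.
      have := H (x - N%:~R) ltac:(clear -xuv; lra).
      by rewrite /h addrC subrK lee_fin opprD addrA.
    by rewrite lee_fin NK; clear; lra.
  - by move=> u v A1 A2 A12 H; apply: le_trans H _; rewrite lee_fin.
have S : slices l%:R m k (a - N%:~R) (b - N%:~R) h ar f.
  split => //.
  - by rewrite subr_ge0.
  (* [l] times the end piece is an integer and positive, hence at least 1. *)
  - apply: (integer_pos_ge1 _ (l%:Z + ia + l%:Z * N)).
      by rewrite !intrD intrM -!pmulrn -la; ring.
    by rewrite mulr_gt0//; [move: l2R|move: N2]; clear; lra.
  - apply: (integer_pos_ge1 _ (ib - l%:Z * N - l%:Z * m)).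
      by rewrite !intrB !intrM -!pmulrn -lb; ring.
    by rewrite mR mulr_gt0//; [move: l2R|move: M1]; clear; lra.
  - by rewrite mR subrK.
  - by move=> j jm; rewrite /h; have [+ _] := Hf j; rewrite intrD -pmulrn.
  - apply: (body_slices_count N m f B) => j jm.
    have [_ [->|nf]] := Hf j; first by exists 0.
    have j1 : 1 <= j%:R :> R by rewrite ler1n; move: jm; clear; lia.
    have jM : j%:R <= M%:~R - 1 :> R by rewrite -mR ler_nat; move: jm; clear; lia.
    apply: (body_slice_points _ _ _ _ _ _ B Pa Pb _ _ nf); rewrite intrD -pmulrn.
    + by move: j1 N2; clear; lra.
    + by move: jM M1; clear; lra.
  - move=> t tw.
    have [|||x [y1 [y2 [P1 P2 ty]]]] := long_chord _ _ _ _ _ cv Pa Pb ab _ _ t.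
    + by move=> s Ps; rewrite amax//= bmax.
    + move=> c; have [|y [z [Py Pz yz]]] := T (- c) 1; first by [].
      exists y, z; split => //; apply: le_trans (yz _ _ Pb Pa).
      by rewrite /form/= !mul0r !addr0 !mul1r.
    + by move: tw; clear; lra.
    exists (x - N%:~R).
      by have := amax _ P1; have := bmax _ P1; clear; move=> /=; lra.
    apply: lt_le_trans ty _; rewrite /h (addrC N%:~R) subrK.
    exact: (chord_le _ _ bd _ _ _ P1 P2).
have := slices_area S m0; rewrite /ar !(addrC N%:~R) !subrK.
rewrite (area_strip _ a b) => [H|z Pz]; last by rewrite amax//= bmax.
apply: H.
- exists (- ia - l%:Z * N).
  by rewrite mulrBr intrB rmorphN/= -la intrM -pmulrn; ring.
- exists (ib - l%:Z * N).
  by rewrite mulrBr intrB -lb intrM -pmulrn; ring.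
Qed.

End BodyArea.

(** * Polygons *)

Section Polygons.
Context {R : realType}.
Local Notation mu := (@lebesgue_measure R).
Implicit Types (P : set (R * R)) (l k : nat) (u v p q c : int).

Lemma body_area {l k P} : (2 <= l)%N -> (2 <= k)%N -> body l k P ->
  ((mu \x mu) P <= (ratio l%:R * (k%:R + 1))%:E)%E.
Proof.
move=> l2 k2 B.
have [p [q [pq T]]] := thinnest_exists (ltnW l2) B.
have mP := body_measurable B.
pose Q P := measurable P -> ((mu \x mu) P <= (ratio l%:R * (k%:R + 1) : R)%:E)%E.
apply: (thinnest_transport Q _ _ l k _ P p q B pq T mP).
- move=> c P' QP' mP'; rewrite -(shear_area c%:~R _ mP').
  exact: (QP' (measurable_shear _ _ mP')).
- move=> P' QP' mP'; rewrite -(swap_area _ mP').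
  exact: (QP' (measurable_swap _ mP')).
- by move=> P' B' T' _; exact: body_area_horizontal.
Qed.

Lemma convex_setP (A : set (plane R)) :
  convex_set A <-> convex_plane (A : set (R * R)).
Proof.
split=> cA.
- move=> y z t Ay Az t01.
  have := cA y z (Itv01 (andP t01).1 (andP t01).2).
  by rewrite !inE => /(_ Ay Az).
- move=> y z t; rewrite !inE => Ay Az.
  by apply: (cA y z t%:num Ay Az); rewrite ge0/= le1.
Qed.

Lemma convhull_convex (A : set (plane R)) : convex_plane (convhull A : set (R * R)).
Proof.
apply/convex_setP => y z t; rewrite !inE => Hy Hz B [cB AB].
have := cB y z t; rewrite !inE; apply; [exact: Hy|exact: Hz].
Qed.

Lemma convhull_sub (A B : set (plane R)) : convex_plane (B : set (R * R)) ->
  A `<=` B -> convhull A `<=` B.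
Proof. by move=> /convex_setP cB AB; exact: smallest_sub. Qed.

Lemma sub_convhull (A : set (plane R)) : A `<=` convhull A.
Proof. exact: sub_gen_smallest. Qed.

Definition mix (x : R * R) (w : R * (R * R)) : R * R :=
  (w.1 * x.1 + (1 - w.1) * w.2.1, w.1 * x.2 + (1 - w.1) * w.2.2).

(** The convex hull as an iterated cone: each stage is a continuous image of [0, 1] times the
    previous one, so compactness follows by induction. *)
Fixpoint hull (s : seq (R * R)) : set (R * R) :=
  if s is x :: s' then
    if s' is [::] then [set x] else mix x @` (`[0, 1]%classic `*` hull s')
  else set0.

Lemma hull_convex s : convex_plane (hull s).
Proof.
elim: s => [|x [|x' s] IH] //=.
  move=> y z t -> -> t01; rewrite /set1/= -!mulrDl addrC subrK !mul1r.
  by case: (x).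
set K := hull (x' :: s) in IH *.
move=> _ _ t [[t1 y1] [/= + Ky1] <-] [[t2 y2] [/= + Ky2] <-] /andP[t0 t01].
rewrite !in_itv/= => /andP[t10 t11] /andP[t20 t21].
(* The total weight of the apex x; the remaining weights are renormalised by 1 - tau, which requires
   tau = 1 to be set apart. *)
pose tau := t * t1 + (1 - t) * t2.
have p1 : 0 <= t * (1 - t1) by rewrite mulr_ge0; lra.
have p2 : 0 <= (1 - t) * (1 - t2) by rewrite mulr_ge0; lra.
have p3 : 0 <= t * t1 by rewrite mulr_ge0; lra.
have p4 : 0 <= (1 - t) * t2 by rewrite mulr_ge0; lra.
have tE : 1 - tau = t * (1 - t1) + (1 - t) * (1 - t2) by rewrite /tau; ring.
have [tau1|tau1] := eqVneq (1 - tau) 0.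
  have e1 : t * (1 - t1) = 0 by lra.
  have e2 : (1 - t) * (1 - t2) = 0 by lra.
  exists (1, y1); first by split; rewrite //= in_itv/= ler01 lexx.
  rewrite /mix/= subrr !mul0r !addr0 !mul1r.
  have tau_1 : t * t1 + (1 - t) * t2 = 1 by rewrite -/tau; lra.
  have E (a b d : R) : t * (t1 * a + (1 - t1) * b) + (1 - t) * (t2 * a + (1 - t2) * d) =
      (t * t1 + (1 - t) * t2) * a + t * (1 - t1) * b + (1 - t) * (1 - t2) * d.
    by ring.
  by rewrite !E tau_1 e1 e2 !mul0r !addr0 !mul1r; case: (x).
have tau0 : 0 < 1 - tau by rewrite lt_neqAle eq_sym tau1 tE addr_ge0.
have H := IH y1 y2 (t * (1 - t1) / (1 - tau)) Ky1 Ky2.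
eexists (tau, _); first split.
- by rewrite /= in_itv/= addr_ge0//= -subr_ge0 ltW.
- apply: H; rewrite divr_ge0 ?(ltW tau0)//= ler_pdivrMr// mul1r tE lerDl.
  exact: p2.
have e : 1 - t * (1 - t1) / (1 - tau) = (1 - t) * (1 - t2) / (1 - tau).
  have -> : (1 - t) * (1 - t2) = (1 - tau) - t * (1 - t1) by rewrite tE; ring.
  by rewrite mulrBl divff.
by rewrite /mix/= e; congr (_, _); rewrite /tau; field.
Qed.

Lemma hull_sub s P : convex_plane P -> [set` s] `<=` P -> hull s `<=` P.
Proof.
move=> cP; elim: s => [|x [|x' s] IH] /= sP.
- by move=> y [].
- by move=> _ ->; apply: sP; rewrite /= inE.
- move=> _ [[t y] [/= + Ky] <-]; rewrite in_itv/= => t01.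
apply: (cP x y t) => //; first by apply: sP; rewrite /= inE eqxx.
by apply: IH Ky => z zs; apply: sP; rewrite /= inE zs orbT.
Qed.

Lemma sub_hull s : [set` s] `<=` hull s.
Proof.
elim: s => [|x [|x' s] IH] /= y; first by rewrite /= in_nil.
  by rewrite /= inE => /eqP.
rewrite /= inE => /predU1P[->|ys].
  exists (1, x'); first split; rewrite /= ?in_itv/= ?lexx ?ler01//.
    by apply: IH; rewrite /= inE eqxx.
  by rewrite /mix/= subrr !mul0r !addr0 !mul1r; case: (x).
exists (0, y); first split; rewrite /= ?in_itv/= ?lexx ?ler01//.
  exact: IH.
by rewrite /mix/= subr0 !mul0r !add0r !mul1r; case: (y).
Qed.

Lemma convhull_seq s : convhull ([set` s] : set (plane R)) = hull s.
Proof.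
apply/seteqP; split.
  by apply: convhull_sub; [exact: hull_convex|exact: sub_hull].
by apply: hull_sub; [exact: convhull_convex|exact: sub_convhull].
Qed.

Lemma hull_compact s : compact (hull s).
Proof.
elim: s => [|x [|x' s] IH]; first exact: compact0.
  exact: compact_set1.
rewrite [hull _]/=; apply: continuous_compact.
  apply: continuous_subspaceT => w.
  have c1 : w'.1 @[w' --> w] --> w.1 by exact: cvg_fst.
  have c2 : w'.2 @[w' --> w] --> w.2 by exact: cvg_snd.
  have c21 : w'.2.1 @[w' --> w] --> w.2.1.
    by apply: (cvg_comp _ _ c2); exact: cvg_fst.
  have c22 : w'.2.2 @[w' --> w] --> w.2.2.
    by apply: (cvg_comp _ _ c2); exact: cvg_snd.
  have cN : 1 - w'.1 @[w' --> w] --> 1 - w.1 by apply: cvgB => //; exact: cvg_cst.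
  apply: (@cvg_pair _ _ _ _ (nbhs (mix x w).1) (nbhs (mix x w).2)).
    by apply: cvgD; apply: cvgM => //; exact: cvg_cst.
  by apply: cvgD; apply: cvgM => //; exact: cvg_cst.
by apply: compact_setX; [exact: segment_compact|exact: IH].
Qed.

Lemma hull_closed s : closed (hull s).
Proof. by apply: compact_closed (hull_compact s); exact: norm_hausdorff. Qed.

Lemma lex_max (f g : R * R -> R) (s : seq (R * R)) : s != [::] ->
  exists2 v, v \in s & forall w, w \in s -> f w < f v \/ f w = f v /\ g w <= g v.
Proof.
elim: s => // x [|x' s] IH _.
  by exists x; rewrite ?inE// => w; rewrite inE => /eqP ->; right.
have [//|v vs vmax] := IH.
have [xv|] := pselect (f x < f v \/ f x = f v /\ g x <= g v).
  by exists v => [|w]; rewrite inE ?vs ?orbT// => /predU1P[->|/vmax].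
move=> /not_orP[/negP]; rewrite -leNgt => fvx /not_andP nfg.
exists x => [|w]; first by rewrite inE eqxx.
rewrite inE => /predU1P[->|/vmax wv]; first by right.
have [fe|fn] := eqVneq (f v) (f x).
  have gvx : g v < g x.
    by case: nfg => [/(_ (esym fe))//|/negP]; rewrite -ltNge.
  case: wv => [wv|[-> gw]]; first by left; rewrite -fe.
  by right; split => //; exact: le_trans gw (ltW gvx).
have fvx' : f v < f x by rewrite lt_neqAle fn.
left; case: wv => [wv|[-> _]] //; exact: lt_trans fvx'.
Qed.

Lemma average_max {t a b m : R} : 0 < t -> t < 1 -> a <= m -> b <= m ->
  m = t * a + (1 - t) * b -> a = m /\ b = m.
Proof.
move=> t0 t1 am bm E; have t1' : 0 < 1 - t by rewrite subr_gt0.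
have A : 0 <= t * (m - a) by rewrite mulr_ge0 ?subr_ge0// ltW.
have B : 0 <= (1 - t) * (m - b) by rewrite mulr_ge0 ?subr_ge0// ltW.
have A0 : t * (m - a) = 0 by lra.
have B0 : (1 - t) * (m - b) = 0 by lra.
have a0 : m - a = 0 by apply/eqP; move: A0 => /eqP; rewrite mulf_eq0 (gt_eqF t0).
have b0 : m - b = 0 by apply/eqP; move: B0 => /eqP; rewrite mulf_eq0 (gt_eqF t1').
by split; clear -a0 b0; lra.
Qed.

(* Maximising [form u v], then the independent form [(- v, u)], singles out an
   extreme point. *)
Lemma vertex_max (s : seq (R * R)) u v : s != [::] -> (u, v) <> (0, 0) ->
  exists z, [/\ hull s z, vertices (hull s : set (plane R)) z &
    forall y, hull s y -> form u v y <= form u v z].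
Proof.
move=> s0 uv0; have [z zs zmax] := lex_max (form u v) (form (- v) u) s s0.
have formD p q y w (t : R) :
    form p q (t * y.1 + (1 - t) * w.1, t * y.2 + (1 - t) * w.2) =
    t * form p q y + (1 - t) * form p q w by rewrite /form/=; ring.
(* The lexicographic half-plane below [z] is convex and contains [s], hence the hull. *)
pose L := [set y : R * R | form u v y < form u v z \/
  form u v y = form u v z /\ form (- v) u y <= form (- v) u z].
have cL : convex_plane L.
  move=> y w t; rewrite /L/= !formD => Ly Lw /andP[t0 t1].
  move: (form u v y) (form u v w) (form u v z) (form (- v) u y) (form (- v) u w)
    (form (- v) u z) Ly Lw => fy fw fz gy gw gz Ly Lw.
  have t1' : 0 <= 1 - t by rewrite subr_ge0.
  have [t_0|tn0] := eqVneq t 0; first by rewrite t_0 subr0 !mul0r !add0r !mul1r.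
  have [t_1|tn1] := eqVneq (1 - t) 0.
    have -> : t = 1 by lra.
    by rewrite subrr !mul0r !addr0 !mul1r.
  have tp : 0 < t by rewrite lt_neqAle eq_sym tn0.
  have tp' : 0 < 1 - t by rewrite lt_neqAle eq_sym tn1.
  case: Ly => [yz|[-> gyz]].
    left; have : 0 < t * (fz - fy) by rewrite mulr_gt0// subr_gt0.
    have : 0 <= (1 - t) * (fz - fw).
      by rewrite mulr_ge0// subr_ge0; case: Lw => [/ltW|[-> _]].
    by clear; lra.
  case: Lw => [wz|[-> gwz]].
    left; have : 0 < (1 - t) * (fz - fw) by rewrite mulr_gt0// subr_gt0.
    by clear; lra.
  right; split; first by ring.
  have : 0 <= t * (gz - gy) by rewrite mulr_ge0// subr_ge0.
  have : 0 <= (1 - t) * (gz - gw) by rewrite mulr_ge0// subr_ge0.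
  by clear; lra.
have sL : hull s `<=` L by apply: hull_sub => // y; exact: zmax.
have fle y : hull s y -> form u v y <= form u v z.
  by move=> /sL[/ltW|[->]].
exists z; split => //; first exact: sub_hull.
split; first exact: sub_hull.
move=> y w t Ky Kw /andP[t0 t1] zE.
have ez p q : form p q z = t * form p q y + (1 - t) * form p q w.
  by rewrite -formD zE.
have [fy fw] := average_max t0 t1 (fle _ Ky) (fle _ Kw) (ez u v).
have gle x : hull s x -> form u v x = form u v z -> form (- v) u x <= form (- v) u z.
  by move=> /sL[+ e|[_ ]//]; rewrite e ltxx.
have [gy gw] := average_max t0 t1 (gle _ Ky fy) (gle _ Kw fw) (ez (- v) u).
(* The determinant of the two forms, so equal values of both forms identify y and w. *)
have n0 : (u%:~R ^+ 2 + v%:~R ^+ 2 : R) != 0.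
  rewrite paddr_eq0 ?sqr_ge0// !sqrf_eq0 !intr_eq0.
  by apply/andP => -[/eqP u0 /eqP v0]; apply: uv0; rewrite u0 v0.
move: fy fw gy gw; rewrite /form rmorphN/= => fy fw gy gw.
have e1 : (u%:~R ^+ 2 + v%:~R ^+ 2) * (y.1 - w.1) = 0.
  rewrite (_ : _ * _ = u%:~R * ((u%:~R * y.1 + v%:~R * y.2) - (u%:~R * w.1 + v%:~R * w.2))
   - v%:~R * ((- v%:~R * y.1 + u%:~R * y.2) - (- v%:~R * w.1 + u%:~R * w.2))); last by ring.
  by rewrite fy fw gy gw !subrr !mulr0 subr0.
have e2 : (u%:~R ^+ 2 + v%:~R ^+ 2) * (y.2 - w.2) = 0.
  rewrite (_ : _ * _ = v%:~R * ((u%:~R * y.1 + v%:~R * y.2) - (u%:~R * w.1 + v%:~R * w.2))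
   + u%:~R * ((- v%:~R * y.1 + u%:~R * y.2) - (- v%:~R * w.1 + u%:~R * w.2))); last by ring.
  by rewrite fy fw gy gw !subrr !mulr0 addr0.
move: e1 e2 => /eqP + /eqP; rewrite !mulf_eq0 (negPf n0)/= !subr_eq0.
by case: (y) (w) => [y1 y2] [w1 w2] /= /eqP -> /eqP ->.
Qed.

Lemma vertices_dilate (P : set (plane R)) (l : nat) z : (0 < l)%N ->
  vertices P z -> vertices (dilate l P) ((l%:R : R) *: z).
Proof.
move=> l0 [Pz Vz]; have l0R : (l%:R : R) != 0 by rewrite pnatr_eq0 -lt0n.
split; first by exists z.
move=> _ _ t [y Py <-] [w Pw <-] t01 E.
rewrite (Vz y w t) //; apply: (scalerI l0R); rewrite E.
by rewrite scalerDr !scalerA ![l%:R * _]mulrC.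
Qed.

Lemma interior_insideP P z : (P : set (plane R))° z <-> inside P z.
Proof.
rewrite /interior; split.
- move=> /nbhs_ballP[e /= e0 He]; exists (e / 2); first by rewrite divr_gt0.
  move=> x y hx hy; apply: He; split; rewrite /ball/= distrC.
    by apply: le_lt_trans hx _; lra.
  by apply: le_lt_trans hy _; lra.
- move=> [r r0 H]; apply/nbhs_ballP; exists r => // -[x y] [/= hx hy].
  by apply: H; rewrite distrC; exact: ltW.
Qed.

Lemma int_numE (x : R) : (x \is a Num.int) <-> exists i : int, x = i%:~R.
Proof. by split=> [/intrP//|[i ->]]; exact: intr_int. Qed.

Lemma polygon_body (P : set (plane R)) l k : (2 <= k)%N -> rational_polygon P ->
  has_denominator P l -> interior_integral_points P #= `I_k -> body l k P.
Proof.
move=> k2 [[[A Afin PE] _] _] [l0 lint _] Pk.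
have /finite_seqP[s sE] := Afin; rewrite {}PE sE convhull_seq in lint Pk *.
have lat (z : R * R) : interior_integral_points (hull s : set (plane R)) z <->
    exists i j : int, z = (i%:~R, j%:~R) /\ inside (hull s) z.
  split.
    move=> [/interior_insideP Hz [/int_numE[i zi] /int_numE[j zj]]].
    by exists i, j; split => //; rewrite -zi -zj; case: (z).
  move=> [i [j [-> Hz]]]; split; first exact/interior_insideP.
  by split; apply/int_numE; [exists i|exists j].
have [z0 /lat[i0 [j0 [z0E z0in]]]] :
    interior_integral_points (hull s : set (plane R)) !=set0.
  apply/set0P/eqP => e; move: Pk; rewrite e card_eq_sym card_eq0 => /eqP /seteqP[/(_ 0%N) /= H _].
  by apply: H; exact: ltnW.
have Kz0 : hull s z0.
  by case: z0in => r r0 H; case: (z0) H => z1 z2 H;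
    apply: H; rewrite subrr normr0 ltW.
split.
- exact: hull_convex.
- by apply: closed_measurable_plane; exact: hull_closed.
- move=> u v.
  have s0 : s != [::] by apply/eqP => s0; rewrite s0 in Kz0.
  have [[u0 v0]|uv0] := EM ((u, v) = (0, 0)).
    exists z0; split => //.
      by move=> y _; rewrite u0 v0 /form !mul0r.
    by exists 0; rewrite u0 v0 /form !mul0r addr0 mulr0.
  have [z [Kz Vz zmax]] := vertex_max s u v s0 uv0.
  exists z; split => //.
  have [/= /int_numE[i zi] /int_numE[j zj]] := lint _ (vertices_dilate _ _ _ l0 Vz).
  exists (u * i + v * j); rewrite intrD !intrM -zi -zj /form /GRing.scale/=; ring.
- by exists i0, j0; rewrite -z0E.
(* A list of distinct interior lattice points injects into a set of cardinality k. *)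
- move=> t ut Ht; rewrite -card_le_II.
  pose g (i : nat) : plane R := let w := nth (0, 0) t i in (w.1%:~R, w.2%:~R).
  have ginj : {in `I_(size t) &, injective g}.
    move=> i j; rewrite !inE/= => it jt [/eqP e1 /eqP e2].
    rewrite eqr_int in e1; rewrite eqr_int in e2.
    apply/eqP; rewrite -(nth_uniq (0, 0) it jt ut).
    by move: e1 e2; case: (nth _ t i) (nth _ t j) => [a b] [c d] /= /eqP -> /eqP ->.
  have [_ H1] := (card_eqPle _ _).1 (inj_card_eq ginj).
  have [H2 _] := (card_eqPle _ _).1 Pk.
  apply: card_le_trans H1 (card_le_trans _ H2).
  apply: subset_card_le => _ [i /= it <-]; apply/lat.
  exists (nth (0, 0) t i).1, (nth (0, 0) t i).2; split => //.
  by apply: Ht; exact: mem_nth.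
Qed.

End Polygons.

(** * The extremal triangle *)

Section Triangle.
Context {R : realType}.
Local Notation mu := (@lebesgue_measure R).
Implicit Types (A P : set (plane R)) (l k : nat).

(* Deleting an extreme point from a convex set leaves a convex set. *)
Lemma vertices_convhull A : vertices (convhull A) `<=` A.
Proof.
move=> z [Cz Vz]; have [//|nAz] := EM (A z).
suff H : convhull A `<=` convhull A `\ z by have [_ /(_ erefl)] := H z Cz.
apply: convhull_sub; last first.
  by move=> y Ay; split; [exact: sub_convhull|move=> yz; apply: nAz; rewrite -yz].
move=> y w t [Cy yz] [Cw wz] t01; split; first exact: convhull_convex.
move=> /= E; have [t0|tn0] := eqVneq t 0.
  by apply: wz; rewrite -E t0 subr0 !mul0r !add0r !mul1r; case: (w).
have [t1|tn1] := eqVneq t 1.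
  by apply: yz; rewrite -E t1 subrr !mul0r !addr0 !mul1r; case: (y).
have yw : y = w.
  apply: (Vz y w t) => //.
  by rewrite !lt_neqAle eq_sym tn0 tn1.
by apply: yz; rewrite -E -yw -!mulrDl addrC subrK !mul1r; case: (y).
Qed.

Lemma dilate_vertices P l z : (0 < l)%N -> vertices (dilate l P) z ->
  exists2 x, vertices P x & z = (l%:R : R) *: x.
Proof.
move=> l0 [[x Px <-] Vz]; exists x => //; split=> // y w t Py Pw t01 E.
have l0R : (l%:R : R) != 0 by rewrite pnatr_eq0 -lt0n.
apply: (scalerI l0R); apply: (Vz _ _ t) => //; [by exists y|by exists w|].
by rewrite E scalerDr !scalerA ![_ * l%:R]mulrC.
Qed.

(** Half-plane description of the extremal triangle; the third inequality is its slanted edge, with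
    slope - l (k + 1). *)
Definition triangle l k : set (R * R) :=
  [set z | [/\ 0 <= z.1, 0 <= z.2 &
    l%:R * (k%:R + 1) * z.1 + z.2 <= (l%:R + 1) * (k%:R + 1)]].

Lemma triangle_convex l k : convex_plane (triangle l k).
Proof.
move=> [y1 y2] [z1 z2] t [/= p1 p2 p3] [/= q1 q2 q3] /andP[t0 t1].
have t1' : 0 <= 1 - t by rewrite subr_ge0.
split => /=; try by rewrite addr_ge0// mulr_ge0.
move: (l%:R * (k%:R + 1)) ((l%:R + 1) * (k%:R + 1)) p3 q3 => a b p3 q3.
have := mulr_ge0 t0 (_ : 0 <= b - (a * y1 + y2)).
have := mulr_ge0 t1' (_ : 0 <= b - (a * z1 + z2)).
by rewrite !subr_ge0 => /(_ q3) A /(_ p3) B; lra.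
Qed.

Lemma triangle_corner l k : (0 < l)%N ->
  l%:R * (k%:R + 1) * (1 + l%:R^-1) = (l%:R + 1) * (k%:R + 1) :> R.
Proof. by move=> l0; field; rewrite pnatr_eq0 -lt0n. Qed.

Lemma T_triangleE k l : (0 < l)%N -> T_triangle R k l = triangle l k.
Proof.
move=> l0; have lR : 0 < l%:R :> R by rewrite ltr0n.
have L0 : 0 <= l%:R^-1 :> R by rewrite invr_ge0 ltW.
have k0 : 0 <= k%:R :> R by [].
have a0 : 0 < l%:R * (k%:R + 1) :> R by rewrite mulr_gt0//; lra.
have b0 : 0 < (l%:R + 1) * (k%:R + 1) :> R by rewrite mulr_gt0//; lra.
have ab := triangle_corner l k l0.
rewrite /T_triangle; set A := (X in convhull X); apply/seteqP; split.
  apply: convhull_sub; first exact: triangle_convex.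
  by move=> z [[->|->]|->]; split; rewrite /= ?mulr0 ?addr0 ?add0r ?ab ?(ltW b0)//; lra.
have Ac : convex_plane (convhull A) by exact: convhull_convex.
have A1 : convhull A (0, 0) by apply: sub_convhull; left; left.
have A2 : convhull A (1 + l%:R^-1, 0) by apply: sub_convhull; left; right.
have A3 : convhull A (0, (l%:R + 1) * (k%:R + 1)) by apply: sub_convhull; right.
move: (convhull A) Ac A1 A2 A3 => C cC; rewrite -ab /triangle -ab.
move: (l%:R * (k%:R + 1)) (1 + l%:R^-1) a0 b0 ab => a w a0 b0 ab A1 A2 A3.
have w0 : 0 < w by move: b0; rewrite -ab pmulr_rgt0.
move=> [x y] [/= x0 y0 xy].
have xw : x <= w by rewrite -(ler_pM2l a0); lra.
have [xE|xn] := eqVneq x w.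
  have -> // : y = 0; last by rewrite xE.
  by rewrite xE in xy; clear -xy y0; lra.
have xw' : x < w by rewrite lt_neqAle xn.
have d0 : 0 < w - x by rewrite subr_gt0.
(* The point where the line through (w, 0) and (x, y) meets the vertical axis; (x, y) lies between
   it and (w, 0). *)
have B : C (0, y * w / (w - x)).
  have := cC _ _ (y / (a * (w - x))) A3 A1; rewrite /= !mulr0 !addr0.
  rewrite (_ : y / _ * _ = y * w / (w - x)); last by field; rewrite !gt_eqF.
  have p0 : 0 < a * (w - x) by rewrite mulr_gt0.
  apply; rewrite divr_ge0 ?(ltW p0)//= ler_pdivrMr// mul1r.
  by rewrite mulrBr; lra.
have := cC _ _ (x / w) A2 B; rewrite /= !mulr0 !addr0 add0r.
rewrite divfK ?gt_eqF//.
rewrite (_ : (1 - x / w) * _ = y); last by field; rewrite !gt_eqF.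
by apply; rewrite divr_ge0 ?(ltW w0)//= ler_pdivrMr// mul1r.
Qed.

Lemma inside_triangle l k z : inside (triangle l k) z <->
  [/\ 0 < z.1, 0 < z.2 &
    l%:R * (k%:R + 1) * z.1 + z.2 < (l%:R + 1) * (k%:R + 1)].
Proof.
rewrite /triangle; have : 0 <= l%:R * (k%:R + 1) :> R by rewrite mulr_ge0// addr_ge0.
move: (l%:R * (k%:R + 1)) ((l%:R + 1) * (k%:R + 1)) => a b a0; split.
  case=> r r0 H.
  have [||/= x0 _ _] := H (z.1 - r) z.2.
  - by rewrite addrC addKr normrN gtr0_norm.
  - by rewrite subrr normr0 ltW.
  have [||/= _ y0 _] := H z.1 (z.2 - r).
  - by rewrite subrr normr0 ltW.
  - by rewrite addrC addKr normrN gtr0_norm.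
  have [||/= _ _ xy] := H z.1 (z.2 + r).
  - by rewrite subrr normr0 ltW.
  - by rewrite addrC addKr gtr0_norm.
  by split; lra.
move=> [x0 y0 xy].
(* A displacement of at most d in each coordinate raises a x + y by at most (a + 1) d. *)
have d0 : 0 < (b - (a * z.1 + z.2)) / (a + 1) by rewrite divr_gt0; lra.
set d := _ / _ in d0.
have dE : (a + 1) * d = b - (a * z.1 + z.2) by rewrite mulrC divfK//; lra.
exists (Num.min z.1 (Num.min z.2 d)); first by rewrite !lt_min x0 y0.
move=> x y; rewrite !le_min => /and3P[+ _ +] /and3P[_ + +].
rewrite !ler_norml => /andP[h1 _] /andP[_ h2] /andP[h3 _] /andP[_ h4].
split => /=; try lra.
have := mulr_ge0 a0 (_ : 0 <= d - (x - z.1)); rewrite subr_ge0 => /(_ h2).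
lra.
Qed.

Lemma triangle_area l k : (0 < l)%N ->
  (mu \x mu)%E (triangle l k) = ((l%:R + 1) ^+ 2 / (2 * l%:R) * (k%:R + 1))%:E.
Proof.
move=> l0; have lR : 0 < l%:R :> R by rewrite ltr0n.
have L0 : 0 <= l%:R^-1 :> R by rewrite invr_ge0 ltW.
have a0 : 0 < l%:R * (k%:R + 1) :> R by rewrite mulr_gt0// ltr_wpDl.
have ab := triangle_corner l k l0.
rewrite (@area_strip _ _ 0 (1 + l%:R^-1)); last first.
  move=> [x y] [/= x0 y0 xy]; rewrite x0/= -(ler_pM2l a0) ab; lra.
transitivity (\int[mu]_(x in `[0%R, (1 + l%:R^-1)%R])
    ((l%:R + 1) * (k%:R + 1) + - (l%:R * (k%:R + 1)) * (x - 0))%:E)%E.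
  apply: eq_integral => x; rewrite inE/= in_itv/= => /andP[x0 xw].
  have xw' : l%:R * (k%:R + 1) * x <= (l%:R + 1) * (k%:R + 1).
    by rewrite -ab ler_pM2l.
  rewrite subr0 mulNr (_ : xsection _ x =
    `[0, (l%:R + 1) * (k%:R + 1) - l%:R * (k%:R + 1) * x]%classic).
    by rewrite lebesgue_measure_itv/= lte_fin subr_gt0 oppr0 adde0; case: ltgtP xw'
      => // ->; rewrite subrr.
  apply/seteqP; split => y; rewrite /xsection/= inE/= in_itv/=.
    by move=> [/= _ -> xy]; rewrite lerBrDl.
  by move=> /andP[y0]; rewrite lerBrDl.
rewrite integral_affine; last lra.
by congr (_%:E); field; rewrite gt_eqF.
Qed.

Lemma T_triangle_polygon k l : (0 < l)%N -> rational_polygon (T_triangle R k l).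
Proof.
move=> l0; split.
  split; first by exists [set (0, 0); (1 + l%:R^-1, 0); (0, (l%:R + 1) * (k%:R + 1))].
  have lR : 0 < l%:R :> R by rewrite ltr0n.
  exists (2^-1, 2^-1); rewrite T_triangleE//; apply/interior_insideP/inside_triangle.
  have k0 : 0 <= k%:R :> R by [].
  have : 0 <= l%:R * k%:R :> R by rewrite mulr_ge0// ltW.
  by split => /=; lra.
move=> z /vertices_convhull [[->|->]|->]; split => /=;
  try by exists 0; rewrite ?rmorph0.
  by exists (1 + l%:R^-1); rewrite // rmorphD fmorphV rmorph1 /= ratr_nat.
exists ((l%:R + 1) * (k%:R + 1)) => //.
by rewrite rmorphM !rmorphD rmorph1 /= !ratr_nat.
Qed.

Lemma T_triangle_denominator k l : (0 < l)%N -> has_denominator (T_triangle R k l) l.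
Proof.
move=> l0; have lR : 0 < l%:R :> R by rewrite ltr0n.
split => //.
  move=> _ /(dilate_vertices _ _ _ l0)[x /vertices_convhull xA ->].
  case: xA => [[->|->]|->]; split; rewrite /= /GRing.scale/= ?mulr0 ?rpred0//.
    by rewrite mulrDr divff ?gt_eqF// mulr1 rpredD ?rpred1// natr_int.
  by rewrite !rpredM ?rpredD ?rpred1 ?natr_int.
move=> m m0 Hm.
(* This vertex alone determines the denominator: m (1 + 1/l) is an integer only if l divides m. *)
have V : vertices (T_triangle R k l) (1 + l%:R^-1, 0).
  rewrite T_triangleE//; have ab := triangle_corner l k l0.
  have a0 : 0 < l%:R * (k%:R + 1) :> R by rewrite mulr_gt0// ltr_wpDl.
  split.
    by split; rewrite //= ?addr_ge0 ?invr_ge0// addr0 ab.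
  move=> [y1 y2] [z1 z2] t [/= y10 y20 yy] [/= z10 z20 zz] /andP[t0 t1].
  move=> [] /= + _; rewrite /GRing.scale/= => E.
  have yw : y1 <= 1 + l%:R^-1 by rewrite -(ler_pM2l a0) ab; lra.
  have zw : z1 <= 1 + l%:R^-1 by rewrite -(ler_pM2l a0) ab; lra.
  have [yE zE] := average_max t0 t1 yw zw E.
  rewrite yE ab in yy; rewrite zE ab in zz.
  by rewrite yE zE; congr (_, _); lra.
have [/= /int_numE[i +] _] := Hm _ (vertices_dilate _ _ _ m0 V).
rewrite /GRing.scale/= => iE.
have : m%:R * (l%:R + 1) = i%:~R * l%:R :> R by rewrite -iE; field; rewrite gt_eqF.
rewrite natr1 -natrM !pmulrn -intrM => /intr_inj E; move: m0 l0 E; clear=> m0 l0 E.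
have mE : m%:Z = (i - m%:Z) * l%:Z by move: E; clear; nia.
have : 0 < i - m%:Z by rewrite -(pmulr_lgt0 _ (_ : 0 < l%:Z))// -mE.
by move: mE; clear; nia.
Qed.

(** On x = 1 the open slice is 0 < y < k + 1; for x >= 2 the slanted edge forces y < (1 - l) (k + 1)
    <= 0. *)
Lemma T_triangle_points k l : (0 < l)%N ->
  interior_integral_points (T_triangle R k l) #= `I_k.
Proof.
move=> l0; have lR : 1 <= l%:R :> R by rewrite ler1n.
have k0 : 0 <= k%:R :> R by [].
rewrite T_triangleE//.
pose f (i : nat) : plane R := (1, i%:R + 1).
have finj : {in `I_k &, injective f}.
  by move=> i j _ _ [/addIr/eqP]; rewrite eqr_nat => /eqP.
suff -> : interior_integral_points (triangle l k : set (plane R)) = f @` `I_k.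
  exact: inj_card_eq.
apply/seteqP; split.
  move=> [x y] [/interior_insideP/inside_triangle [/= x0 y0 xy]].
  move=> [/= /int_numE[i xi] /int_numE[j yj]]; subst x y.
  have i1 : i = 1.
    have i0 : 1 <= i by move: x0; rewrite ltr0z; clear; lia.
    have [i2|] := leP 2 i; last by lia.
    exfalso.
    have : 2 <= i%:~R :> R by rewrite (ler_int R 2).
    rewrite -subr_ge0 => i2R.
    have : 0 <= l%:R * (k%:R + 1) * (i%:~R - 2) :> R.
      by rewrite !mulr_ge0//; lra.
    have : 0 <= (l%:R - 1) * (k%:R + 1) :> R by rewrite mulr_ge0//; lra.
    by move: xy y0; clear; lra.
  subst i; rewrite mulr1 in xy.
  have jk : j%:~R < (k.+1%:Z)%:~R :> R by rewrite -pmulrn -natr1; lra.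
  rewrite ltr_int in jk; rewrite ltr0z in y0.
  exists (`|j|%N.-1) => /=; first lia.
  rewrite /f; congr (_, _); rewrite natr1 prednK ?absz_gt0 ?gt_eqF//.
  by rewrite pmulrn gtz0_abs.
move=> _ [i /= ik <-]; split.
  apply/interior_insideP/inside_triangle; rewrite /f/=.
  have : i.+1%:R <= k%:R :> R by rewrite ler_nat.
  by rewrite -natr1 => ikR; have : 0 <= i%:R :> R by []; split; lra.
by split; rewrite /f/= ?rpred1// natr1 natr_int.
Qed.

End Triangle.

Theorem corollary3p8 (R : realType) (k l : nat) (hl : (2 <= l)%N)
    (hk : (1 < k)%N) :
  [/\ forall P : set (plane R),
        rational_polygon P -> has_denominator P l ->
        interior_integral_points P #= `I_k ->
        (area P <= area (T_triangle R k l))%E,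
      area (T_triangle R k l) =
        ((l%:R + 1) ^+ 2 / (2 * l%:R) * (k%:R + 1))%:E &
      exists P : set (plane R),
        [/\ rational_polygon P, has_denominator P l,
            interior_integral_points P #= `I_k &
            area P = area (T_triangle R k l)]].
Proof.
have l0 : (0 < l)%N by exact: ltnW.
have Tarea : area (T_triangle R k l) =
    ((l%:R + 1) ^+ 2 / (2 * l%:R) * (k%:R + 1))%:E.
  by rewrite T_triangleE//; exact: triangle_area.
split => //.
  move=> P rP dP kP; rewrite Tarea.
  exact: body_area hl hk (polygon_body P l k hk rP dP kP).
exists (T_triangle R k l); split => //.
- exact: T_triangle_polygon.
- exact: T_triangle_denominator.
- exact: T_triangle_points.
Qed.
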